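(* In the setting described in the context, there exists a constant $C>0$, depending on $r$ but independent of $K\ge r$ and of $c$, such that for every $K\ge r$ and every $c>0$, $$W_{\mathrm{MC}}(c)-W_K(c)\le \frac{C}{\sqrt K}.$$ Consequently $V_{\mathrm{MC}}-V_K\le \dfrac{C}{\sqrt K}$ for every $K\ge r$.
   Context: Let $1\le r\le K$ be integers and $n\ge1$. Let $\bar{\boldsymbol\zeta}\in\mathbb R^n$, $L_r\in\mathbb R^{n\times r}$, and $L_K:=[L_r,0]\in\mathbb R^{n\times K}$ (the last $K-r$ columns are zero). Let $g:\mathbb R^n\to\mathbb R$ be convex with $g(\bar{\boldsymbol\zeta})<0$. For $m\in\{r,K\}$ and $\boldsymbol v\in\mathbb S^{m-1}$ define $\rho_m(\boldsymbol v):=\sup\{t\ge0: g(\bar{\boldsymbol\zeta}+tL_m\boldsymbol v)\le 0\}\in[0,+\infty]$. Let $F_{\chi_m}$ denote the CDF of the Chi distribution with $m$ degrees of freedom, with $F_{\chi_m}(+\infty)=1$. Let $\boldsymbol\nu_m\sim\mathcal U(\mathbb S^{m-1})$ (uniform on the unit sphere), and let $\varphi:=\mathbb P(g(\boldsymbol\zeta)\le 0)$ for $\boldsymbol\zeta\sim\mathcal N(\bar{\boldsymbol\zeta},L_rL_r^T)$. Define $V_K:=\mathrm{Var}(F_{\chi_K}(\rho_K(\boldsymbol\nu_K)))$ (variance of the $K$-dimensional spherical-radial estimator) and $V_{\mathrm{MC}}:=\varphi(1-\varphi)$ (variance of a single standard Monte Carlo indicator sample). Let $\tau_{r,K}:=\|\boldsymbol\nu_K^{(r)}\|_2^2$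 where $\boldsymbol\nu_K^{(r)}$ is the vector of the first $r$ entries of $\boldsymbol\nu_K$ (distributed as $\mathrm{Beta}(r/2,(K-r)/2)$ if $r<K$, equal to $1$ if $r=K$). For $c\ge0$ define $$W_K(c):=\mathbb E_{\tau_{r,K}}\Big[\Big(F_{\chi_K}\big(c/\sqrt{\tau_{r,K}}\big)-F_{\chi_r}(c)\Big)^2\Big],\qquad W_{\mathrm{MC}}(c):=F_{\chi_r}(c)\big(1-F_{\chi_r}(c)\big).$$ *)

(* Defs.v *)
From HB Require Import structures.
From mathcomp Require Import all_boot all_order all_algebra.
From mathcomp Require Import all_classical all_reals all_analysis.
Set Implicit Arguments. Unset Strict Implicit. Unset Printing Implicit Defensive.
Import Order.TTheory GRing.Theory Num.Theory.
Local Open Scope ring_scope.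
Local Open Scope classical_set_scope.

Section Defs.
Variable R : realType.

(* Lebesgue integral over R^m of a (nonnegative) function, defined as the
   iterated one-dimensional Lebesgue integral (Tonelli). *)
Fixpoint iint (m : nat) : ('cV[R]_m -> \bar R) -> \bar R :=
  match m return ('cV[R]_m -> \bar R) -> \bar R with
  | 0 => fun f => f 0
  | m'.+1 => fun f =>
      (\int[@lebesgue_measure R]_x
         iint (fun v : 'cV[R]_m' => f (col_mx (const_mx x : 'cV[R]_1) v)))%E
  end.

Definition sqn m (v : 'cV[R]_m) : R := \sum_(i < m) (v i 0) ^+ 2.

Definition gdens m (z : 'cV[R]_m) : R :=
  ((Num.sqrt (2 * pi))^-1) ^+ m * expR (- sqn z / 2).

Definition Egauss m (h : 'cV[R]_m -> \bar R) : \bar R :=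
  iint (fun z => ((gdens z)%:E * h z)%E).

(* CDF of the Chi distribution with m degrees of freedom (law of |Z|,
   Z ~ N(0,I_m)), evaluated at t in [-oo,+oo]; note F(+oo) = 1. *)
Definition Fchi m (t : \bar R) : R :=
  fine (Egauss (fun z : 'cV[R]_m => if ((Num.sqrt (sqn z))%:E <= t)%E then 1%E else 0%E)).

(* expectation of h(nu), nu ~ U(S^{m-1}); the uniform (normalized surface)
   measure on the sphere is realized as the cone measure:
   sigma(A) = vol{x in B : x/|x| in A} / vol(B), B the closed unit ball. *)
Definition normalize m (v : 'cV[R]_m) : 'cV[R]_m := (Num.sqrt (sqn v))^-1 *: v.
Definition ballvol m : R :=
  fine (iint (fun v : 'cV[R]_m => if sqn v <= 1 then 1%E else 0%E)).
Definition Esph m (h : 'cV[R]_m -> \bar R) : \bar R :=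
  ((ballvol m)^-1%:E *
   iint (fun v : 'cV[R]_m => if (0 < sqn v <= 1)%R then h (normalize v) else 0%E))%E.

Definition tau r K (v : 'cV[R]_K) : R := \sum_(j < K | (j < r)%N) (v j 0) ^+ 2.

Definition W_K r K (c : R) : \bar R :=
  Esph (fun v : 'cV[R]_K =>
    let arg := if tau r v == 0 then +oo%E else (c / Num.sqrt (tau r v))%:E in
    ((Fchi K arg - Fchi r c%:E) ^+ 2)%:E).
Definition W_MC r (c : R) : R := Fchi r c%:E * (1 - Fchi r c%:E).

(* L_K := [L_r, 0] in R^{n x K} *)
Definition LK n r (L : 'M[R]_(n, r)) K : 'M[R]_(n, K) :=
  \matrix_(i < n, j < K) \sum_(k < r | nat_of_ord k == nat_of_ord j) L i k.

Definition rho n r (zb : 'cV[R]_n) (L : 'M[R]_(n, r)) (g : 'cV[R]_n -> R)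
  K (v : 'cV[R]_K) : \bar R :=
  ereal_sup [set (t%:E)%E | t in [set t : R | 0 <= t /\ g (zb + t *: (LK L K *m v)) <= 0]].

Definition V_K n r (zb : 'cV[R]_n) (L : 'M[R]_(n, r)) g K : \bar R :=
  (Esph (fun v : 'cV[R]_K => ((Fchi K (rho zb L g v)) ^+ 2)%:E)
   - (Esph (fun v : 'cV[R]_K => (Fchi K (rho zb L g v))%:E)) ^+ 2)%E.

(* phi = P(g(zeta) <= 0), zeta ~ N(zb, L L^T), i.e. zeta = zb + L Z, Z ~ N(0,I_r) *)
Definition phi n r (zb : 'cV[R]_n) (L : 'M[R]_(n, r)) (g : 'cV[R]_n -> R) : R :=
  fine (Egauss (fun z : 'cV[R]_r => if g (zb + L *m z) <= 0 then 1%E else 0%E)).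

Definition V_MC n r (zb : 'cV[R]_n) (L : 'M[R]_(n, r)) g : R :=
  phi zb L g * (1 - phi zb L g).

Definition convex_fun n (g : 'cV[R]_n -> R) : Prop :=
  forall (x y : 'cV[R]_n) (t : R), 0 <= t <= 1 ->
    g (t *: x + (1 - t) *: y) <= t * g x + (1 - t) * g y.

End Defs.

(* Main.v *)
(* Write the sublevel set as a set [D] of R^K that is star-shaped at 0 and only
   depends on the first r coordinates, and let [G nu = P (|W| nu \in D)] for a
   Gaussian W; this is [F_chi(rho(nu))].  In polar coordinates [E G = P (Z \in D)]
   and [E (G (1 - G)) = P (Z \in D, |W| Z / |Z| \notin D)] for independent
   Gaussians Z and W, and the two variances differ by exactly [E (G (1 - G))].
   Multiplying the first r coordinates of Z by [s \in [1, 2]] changes its density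
   by at most the factor [2 ^ r].  Averaging over s, on each ray the event becomes
   an interval of s of length at most [2 (1 - |Z| / |W|)_+], and the expectation
   of the latter is [O(1 / sqrt K)] because [|Z|^2] and [|W|^2] have mean K and
   deviations of order [sqrt K]. *)
Require Import Defs.
From HB Require Import structures.
From mathcomp Require Import all_boot all_order all_algebra.
From mathcomp Require Import all_classical all_reals all_analysis.
From mathcomp Require Import measurable_realfun.
From mathcomp Require Import ring lra.
Import Order.TTheory GRing.Theory Num.Theory.
Import numFieldNormedType.Exports.
Local Open Scope ring_scope.
Local Open Scope classical_set_scope.
Set Implicit Arguments. Unset Strict Implicit. Unset Printing Implicit Defensive.

(** * Iterated integrals *)

(** Both claims are one inequality for two choices of [D]. Since [E G = p := P (Z \in D)], either
    gap equals [p - E G^2]: on each side the term [p^2] cancels. For the fixed radius [c], [D] is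
    the cylinder over the ball of radius [c] in R^r; for [g], convexity makes [D] star-shaped and
    measurable and makes the supremum in [rho] behave as an exit radius. The obstacle is that
    closeness of [|Z|] and [|W|] relative to [sqrt K] does not make an exit between them unlikely:
    if [D] is the ball of radius [sqrt K] in R^K, then [|Z| <= sqrt K < |W|] keeps a probability
    bounded away from 0. Being a cylinder over r coordinates is what excludes this: dilating those
    alone costs a factor [2 ^ r] whatever K, while dilating all of them would cost [2 ^ K]. The
    dependence of C on r comes from there only. Integrals over R^K are iterated one-dimensional
    ones, so every change of variables is a diagonal dilation combined with Tonelli; this includes
    polar coordinates and the Gaussian moments. *)

Section MeasurableVectors.
Context (R : realType).

(** The sigma-algebra of column vectors is pulled back along this map, so that measurability can be
    tested coordinate by coordinate. *)
Definition tuple_of_cV m (v : 'cV[R]_m) : m.-tuple (measurableTypeR R) :=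
  [tuple v i 0 | i < m].

Section Instance.
Context (m : nat).
Let meas : set (set 'cV[R]_m) :=
  preimage_set_system setT (@tuple_of_cV m) measurable.

Let sa_meas : sigma_algebra setT meas.
Proof. exact/sigma_algebra_preimage/sigma_algebra_measurable. Qed.

Let meas0 : meas set0. Proof. by case: sa_meas. Qed.
Let measC A : meas A -> meas (~` A).
Proof. by case: sa_meas => _ + _ => /[apply]; rewrite setTD. Qed.
Let meas_bigcup (F : (set _)^nat) :
  (forall i, meas (F i)) -> meas (\bigcup_i F i).
Proof. by case: sa_meas => _ _; apply. Qed.

HB.instance Definition _ := @isMeasurable.Build
  (measure_tuple_display default_measure_display)
  'cV[R]_m meas meas0 measC meas_bigcup.
End Instance.

Lemma measurable_coord m (i : 'I_m) :
  measurable_fun setT (fun v : 'cV[R]_m => v i 0 : measurableTypeR R).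
Proof.
have mt : measurable_fun setT (@tuple_of_cV m).
  by move=> _ Y mY; rewrite setTI; exists Y => //; rewrite setTI.
have := measurableT_comp (measurable_tnth i) mt.
by apply: eq_measurable_fun => v _ /=; rewrite tnth_mktuple.
Qed.

Lemma measurable_cVP d (T : measurableType d) m (f : T -> 'cV[R]_m) :
  (forall i, measurable_fun setT (fun t => f t i 0 : measurableTypeR R)) ->
  measurable_fun setT f.
Proof.
move=> mf _ Y [B mB <-]; rewrite !setTI -comp_preimage.
have : measurable_fun setT (@tuple_of_cV m \o f).
  apply/measurable_fun_tnthP => i.
  by have := mf i; apply: eq_measurable_fun => t _ /=; rewrite tnth_mktuple.
by move=> /(_ measurableT _ mB); rewrite setTI.
Qed.

(** Convertible to the vector built inside [iint], which makes [iintS] hold by computation. *)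
Definition vcons m (x : R) (v : 'cV[R]_m) : 'cV[R]_m.+1 :=
  col_mx (const_mx x : 'cV_1) v.

Lemma vcons0 m x (v : 'cV[R]_m) : vcons x v ord0 0 = x.
Proof.
have -> : (ord0 : 'I_m.+1) = lshift m (ord0 : 'I_1) by exact/val_inj.
by rewrite [LHS]col_mxEu mxE.
Qed.

Lemma vconsS m x (v : 'cV[R]_m) (i : 'I_m) : vcons x v (lift ord0 i) 0 = v i 0.
Proof.
have -> : lift (ord0 : 'I_m.+1) i = rshift 1 i by exact/val_inj.
by rewrite [LHS]col_mxEd.
Qed.

Lemma vconsP m (v : 'cV[R]_m.+1) : v = vcons (v ord0 0) (dsubmx (v : 'cV_(1 + m))).
Proof.
apply/colP => i; case: (unliftP ord0 i) => [j ->|->]; last by rewrite vcons0.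
by rewrite vconsS mxE; congr (v _ _); exact/val_inj.
Qed.

Lemma measurable_vcons d (T : measurableType d) m
    (x : T -> measurableTypeR R) (v : T -> 'cV[R]_m) :
  measurable_fun setT x -> measurable_fun setT v ->
  measurable_fun setT (fun t => vcons (x t) (v t)).
Proof.
move=> mx mv; apply: measurable_cVP => i.
case: (unliftP ord0 i) => [j ->|->].
  under eq_fun do rewrite vconsS.
  exact: (measurableT_comp (measurable_coord j)).
by under eq_fun do rewrite vcons0.
Qed.

Lemma iintS m (f : 'cV[R]_m.+1 -> \bar R) :
  iint f = (\int[lebesgue_measure]_x iint (fun v => f (vcons x v)))%E.
Proof. by []. Qed.

Local Open Scope ereal_scope.

Lemma iint_ge0 m (f : 'cV[R]_m -> \bar R) : (forall v, 0 <= f v) -> 0 <= iint f.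
Proof.
elim: m f => [|m IH] f f0; first exact: f0.
by rewrite iintS; apply: integral_ge0 => x _; exact: IH.
Qed.

Lemma eq_iint m (f g : 'cV[R]_m -> \bar R) : f =1 g -> iint f = iint g.
Proof. by move=> /funext ->. Qed.

Lemma iint0 m : iint (fun _ : 'cV[R]_m => 0) = 0.
Proof.
by elim: m => [//|m IH]; rewrite iintS; apply: integral0_eq => x _; exact: IH.
Qed.

(** The parameter space is arbitrary so that the induction can absorb the next coordinate into it,
    passing from [T] to [T * R]. *)
Lemma measurable_iint d (T : measurableType d) m (f : T -> 'cV[R]_m -> \bar R) :
  (forall t v, 0 <= f t v) ->
  measurable_fun setT (fun p : T * 'cV[R]_m => f p.1 p.2) ->
  measurable_fun setT (fun t => iint (f t)).
Proof.
elim: m d T f => [|m IH] d T f f0 mf.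
  exact: (measurableT_comp mf (pair2_measurable (0%R : 'cV[R]_0))).
pose g (p : T * measurableTypeR R) := iint (fun v => f p.1 (vcons p.2 v)).
have mg : measurable_fun setT g.
  apply: IH => [p v|]; first exact: f0.
  apply: (measurableT_comp (f := fun q : T * 'cV_m.+1 => f q.1 q.2)
    (g := fun q : (T * measurableTypeR R) * 'cV_m => (q.1.1, vcons q.1.2 q.2))) => //.
  apply: measurable_fun_pair; first exact: measurableT_comp.
  by apply: measurable_vcons => //; exact: measurableT_comp.
have g0 p : 0 <= g p by apply: iint_ge0 => v; exact: f0.
exact: (measurable_fun_fubini_tonelli_F (m2 := lebesgue_measure) g mg g0).
Qed.

Lemma measurable_vcons2 m (f : 'cV[R]_m.+1 -> \bar R) :
  measurable_fun setT f ->
  measurable_fun setT (fun p : measurableTypeR R * 'cV[R]_m => f (vcons p.1 p.2)).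
Proof.
move=> mf; apply: (measurableT_comp mf).
by apply: measurable_vcons.
Qed.

Lemma measurable_vcons1 m (f : 'cV[R]_m.+1 -> \bar R) x :
  measurable_fun setT f -> measurable_fun setT (fun v : 'cV[R]_m => f (vcons x v)).
Proof. by move=> /measurable_vcons2 mf; exact: (measurableT_comp mf (pair1_measurable (x : measurableTypeR R))). Qed.

Lemma measurable_iint_vcons m (f : 'cV[R]_m.+1 -> \bar R) : (forall v, 0 <= f v) ->
  measurable_fun setT f ->
  measurable_fun setT (fun x : measurableTypeR R => iint (fun v => f (vcons x v))).
Proof.
move=> f0 mf; apply: measurable_iint => [t v|]; first exact: f0.
exact: measurable_vcons2.
Qed.

Lemma le_iint m (f g : 'cV[R]_m -> \bar R) : (forall v, 0 <= f v) ->
  measurable_fun setT f -> measurable_fun setT g ->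
  (forall v, f v <= g v) -> iint f <= iint g.
Proof.
elim: m f g => [|m IH] f g f0 mf mg fg; first exact: fg.
have g0 v : 0 <= g v by exact: le_trans (fg v).
rewrite !iintS; apply: ge0_le_integral => //.
- by move=> x _; exact: iint_ge0.
- exact: measurable_iint_vcons.
- exact: measurable_iint_vcons.
- by move=> x _; apply: IH => //; exact: measurable_vcons1.
Qed.

Lemma iintD m (f g : 'cV[R]_m -> \bar R) : (forall v, 0 <= f v) ->
  (forall v, 0 <= g v) ->
  measurable_fun setT f -> measurable_fun setT g ->
  iint (fun v => f v + g v) = iint f + iint g.
Proof.
elim: m f g => [//|m IH] f g f0 g0 mf mg.
rewrite !iintS -ge0_integralD//.
- by apply: eq_integral => x _; apply: IH => //; exact: measurable_vcons1.
- by move=> x _; exact: iint_ge0.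
- exact: measurable_iint_vcons.
- by move=> x _; exact: iint_ge0.
- exact: measurable_iint_vcons.
Qed.

Lemma iintZl m (f : 'cV[R]_m -> \bar R) (k : \bar R) : 0 <= k ->
  (forall v, 0 <= f v) -> measurable_fun setT f ->
  iint (fun v => k * f v) = k * iint f.
Proof.
move=> k0; elim: m f => [//|m IH] f f0 mf.
rewrite !iintS -ge0_integralZl//.
- by apply: eq_integral => x _; apply: IH => //; exact: measurable_vcons1.
- exact: measurable_iint_vcons.
- by move=> x _; exact: iint_ge0.
Qed.

(** One Tonelli exchange per coordinate: [mu] moves past the outermost Lebesgue integral, and the
    induction handles the others. *)
Lemma iint_integral_swap d (T : measurableType d)
    (mu : {sigma_finite_measure set T -> \bar R}) m (f : T -> 'cV[R]_m -> \bar R) :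
  (forall x v, 0 <= f x v) ->
  measurable_fun setT (fun p : T * 'cV[R]_m => f p.1 p.2) ->
  \int[mu]_x iint (f x) = iint (fun v => \int[mu]_x f x v).
Proof.
elim: m f => [//|m IH] f f0 mf.
have mf' : measurable_fun setT
    (fun p : (T * measurableTypeR R) * 'cV[R]_m => f p.1.1 (vcons p.1.2 p.2)).
  apply: (measurableT_comp (f := fun q : T * 'cV_m.+1 => f q.1 q.2)
    (g := fun q : (T * measurableTypeR R) * 'cV_m => (q.1.1, vcons q.1.2 q.2))) => //.
  apply: measurable_fun_pair; first exact: measurableT_comp.
  by apply: measurable_vcons => //; exact: measurableT_comp.
transitivity (\int[mu]_x \int[lebesgue_measure]_y iint (fun v => f x (vcons y v))) => //.
pose g (p : T * measurableTypeR R) := iint (fun v => f p.1 (vcons p.2 v)).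
have mg : measurable_fun setT g.
  by apply: (measurable_iint (f := fun p v => f p.1 (vcons p.2 v))).
rewrite (fubini_tonelli (m1 := mu) (m2 := lebesgue_measure) g)//; last first.
  by move=> p; exact: iint_ge0.
rewrite iintS; apply: eq_integral => y _; apply: IH => //.
apply: (measurableT_comp (f := fun p => f p.1.1 (vcons p.1.2 p.2))
    (g := fun q : T * 'cV_m => ((q.1, y : measurableTypeR R), q.2))) => //.
by apply: measurable_fun_pair => //; apply: measurable_fun_pair.
Qed.

Lemma iint_swap m n (f : 'cV[R]_m -> 'cV[R]_n -> \bar R) :
  (forall x v, 0 <= f x v) ->
  measurable_fun setT (fun p : 'cV[R]_m * 'cV[R]_n => f p.1 p.2) ->
  iint (fun x => iint (f x)) = iint (fun y => iint (fun x => f x y)).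
Proof.
elim: m f => [//|m IH] f f0 mf.
have mf' : measurable_fun setT
    (fun p : (measurableTypeR R * 'cV[R]_m) * 'cV[R]_n => f (vcons p.1.1 p.1.2) p.2).
  apply: (measurableT_comp (f := fun q : 'cV_m.+1 * 'cV_n => f q.1 q.2)
    (g := fun q : (measurableTypeR R * 'cV_m) * 'cV_n => (vcons q.1.1 q.1.2, q.2))) => //.
  apply: measurable_fun_pair; last by [].
  by apply: measurable_vcons; exact: measurableT_comp.
rewrite iintS; transitivity (\int[lebesgue_measure]_x
    iint (fun y => iint (fun v => f (vcons x v) y))).
  apply: eq_integral => x _; apply: IH => //.
  apply: (measurableT_comp (f := fun p => f (vcons p.1.1 p.1.2) p.2)
    (g := fun q : 'cV_m * 'cV_n => ((x : measurableTypeR R, q.1), q.2))) => //.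
  by apply: measurable_fun_pair => //; apply: measurable_fun_pair.
rewrite iint_integral_swap// => [x v|]; first exact: iint_ge0.
apply: (measurable_iint (f := fun p v => f (vcons p.1 v) p.2)) => //.
apply: (measurableT_comp (f := fun p => f (vcons p.1.1 p.1.2) p.2)
    (g := fun q : (measurableTypeR R * 'cV_n) * 'cV_m => ((q.1.1, q.2), q.1.2))) => //.
by apply: measurable_fun_pair; [apply: measurable_fun_pair|]; try exact: measurableT_comp.
Qed.

End MeasurableVectors.

(** * Homotheties *)

Section Scaling.
Context (R : realType).
Notation mu := (@lebesgue_measure R).
Implicit Types (m : nat).

Section HomothetyOfTheLine.
Variable s : R.
Let homothety : measurableTypeR R -> measurableTypeR R := *%R s.
Let measurable_homothety : measurable_fun setT homothety.
Proof. exact: mulrl_measurable. Qed.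
HB.instance Definition _ := isMeasurableFun.Build _ _ _ _ homothety
  measurable_homothety.

(** By uniqueness on half-open intervals, Lebesgue measure is [s] times its pushforward under the
    homothety of ratio [s]. *)
Lemma integral_scale (f : R -> \bar R) : 0 < s ->
  (forall x, 0 <= f x)%E ->
  measurable_fun setT (f : measurableTypeR R -> _) ->
  (\int[mu]_x f x = s%:E * \int[mu]_x f (s * x)%R)%E.
Proof.
move=> s0 f0 mf.
rewrite (eq_measure_integral
    (mscale (NngNum (ltW s0)) (pushforward mu homothety))); last first.
  move=> A mA _; apply: lebesgue_measure_unique => //= _ [[a b]] _ <-.
  rewrite /mscale /pushforward/=.
  rewrite [X in _ = (_ * mu X)%E](_ : _ = `]a / s, b / s]%classic); last first.
    by apply/seteqP; split => x /=;
      rewrite !in_itv/= ltr_pdivrMr// ler_pdivlMr// ![x * s]mulrC.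
  rewrite !lebesgue_measure_itv/= !lte_fin ltr_pM2r ?invr_gt0//.
  case: ifPn => ab; last by rewrite mule0.
  by rewrite -!EFinB -EFinM -mulrBl mulrCA divff ?mulr1// gt_eqF.
by rewrite ge0_integral_mscale// ge0_integral_pushforward.
Qed.
End HomothetyOfTheLine.

(** The factors are indexed by [nat], so that removing the first coordinate turns [d] into [d \o S]
    without casts. *)
Definition dscale m (d : nat -> R) (v : 'cV[R]_m) : 'cV[R]_m :=
  \col_i (d i * v i 0).

Lemma dscale_vcons m d x (v : 'cV[R]_m) :
  dscale d (vcons x v) = vcons (d 0%N * x) (dscale (d \o S) v).
Proof.
apply/colP => i; rewrite mxE; case: (unliftP ord0 i) => [j ->|->].
  by rewrite !vconsS mxE.
by rewrite !vcons0.
Qed.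

Lemma measurable_dscale m d : measurable_fun setT (@dscale m d).
Proof.
apply: measurable_cVP => i; under eq_fun do rewrite mxE.
by apply: measurable_funM => //; exact: measurable_coord.
Qed.

Lemma iint_dscale m (d : nat -> R) (f : 'cV[R]_m -> \bar R) :
  (forall i, 0 < d i) -> (forall v, 0 <= f v)%E -> measurable_fun setT f ->
  (iint f = (\prod_(i < m) d i)%:E * iint (f \o dscale d))%E.
Proof.
elim: m d f => [|m IH] d f d0 f0 mf.
  rewrite big_ord0 mul1e; congr f; apply/colP => -[]//.
rewrite !iintS (integral_scale (d0 0%N)) => [|x|]; last 2 first.
  exact: iint_ge0.
  exact: measurable_iint_vcons.
rewrite (eq_integral (fun x : measurableTypeR R => ((\prod_(i < m) (d \o S) i)%:E *
    iint (fun v => f (vcons (d 0%N * (x : R)) (dscale (d \o S) v))))%E)); last first.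
  by move=> x _; apply: IH => // ; [move=> i; exact: d0|exact: measurable_vcons1].
rewrite ge0_integralZl_EFin//; last 3 first.
- by move=> x _; exact: iint_ge0.
- apply: (measurable_iint (f := fun x v => f (vcons (d 0%N * x) (dscale (d \o S) v)))) => //.
  apply: (measurableT_comp mf); apply: measurable_vcons.
    exact: measurable_funM.
  exact: (measurableT_comp (measurable_dscale _) measurable_snd).
- by apply: prodr_ge0 => i _; apply: ltW; exact: d0.
rewrite muleA -EFinM big_ord_recl/=; congr (_ * _)%E.
by apply: eq_integral => x _; apply: eq_iint => v /=; rewrite dscale_vcons.
Qed.

Lemma iint_scale m (s : R) (f : 'cV[R]_m -> \bar R) : 0 < s ->
  (forall v, 0 <= f v)%E -> measurable_fun setT f ->
  (iint f = (s ^+ m)%:E * iint (fun v => f (s *: v)))%E.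
Proof.
move=> s0 f0 mf; rewrite (iint_dscale (d := fun=> s))// prodr_const card_ord.
congr (_ * _)%E; apply: eq_iint => v /=; congr f; apply/colP => i.
by rewrite !mxE.
Qed.

Lemma sqn_ge0 m (v : 'cV[R]_m) : 0 <= sqn v.
Proof. by apply: sumr_ge0 => i _; exact: sqr_ge0. Qed.

Lemma sqn_vcons m x (v : 'cV[R]_m) : sqn (vcons x v) = x ^+ 2 + sqn v.
Proof.
rewrite /sqn big_ord_recl vcons0; congr (_ + _).
by apply: eq_bigr => i _; rewrite vconsS.
Qed.

Lemma sqnZ m (s : R) (v : 'cV[R]_m) : sqn (s *: v) = s ^+ 2 * sqn v.
Proof.
by rewrite /sqn mulr_sumr; apply: eq_bigr => i _; rewrite mxE exprMn.
Qed.

Lemma sqn_eq0 m (v : 'cV[R]_m) : sqn v = 0 -> v = 0.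
Proof.
move=> /eqP; rewrite psumr_eq0 => [/allP h|i _]; last exact: sqr_ge0.
apply/colP => i; rewrite mxE; apply/eqP; rewrite -sqrf_eq0.
by apply: h; rewrite mem_index_enum.
Qed.

Lemma measurable_sqn m : measurable_fun setT (@sqn R m : _ -> measurableTypeR R).
Proof.
apply: measurable_sum => i; apply: (measurable_funX (f := fun v : 'cV_m => v i 0)).
exact: measurable_coord.
Qed.

Lemma measurable_sqrtr :
  measurable_fun setT (@Num.sqrt R : measurableTypeR R -> measurableTypeR R).
Proof.
apply: nondecreasing_measurable => // x y xy; exact: ler_wsqrtr.
Qed.

Lemma measurable_invr :
  measurable_fun setT (@GRing.inv R : measurableTypeR R -> measurableTypeR R).
Proof.
(* The power of exponent -1 is an inverse on nonnegative reals only; applied to the square it serves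
   both signs, and at 0 both sides vanish. *)
have -> : @GRing.inv R = fun x => x * (x ^+ 2) `^ (-1).
  apply/funext => x; rewrite powR_inv1 ?sqr_ge0//.
  have [->|x0] := eqVneq x 0; first by rewrite invr0 mul0r.
  by rewrite expr2 invfM mulrA divff// mul1r.
apply: measurable_funM => //.
apply: (measurableT_comp (f := fun x : R => x `^ (-1))); first exact: measurable_powR.
exact: exprn_measurable.
Qed.

Lemma measurable_scalemx d (T : measurableType d) m
    (x : T -> measurableTypeR R) (v : T -> 'cV[R]_m) :
  measurable_fun setT x -> measurable_fun setT v ->
  measurable_fun setT (fun t => x t *: v t).
Proof.
move=> mx mv; apply: measurable_cVP => i.
under eq_fun do rewrite mxE.
apply: measurable_funM => //.
exact: (measurableT_comp (measurable_coord i)).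
Qed.

Definition vnorm m (v : 'cV[R]_m) : R := Num.sqrt (sqn v).

Lemma measurable_vnorm m : measurable_fun setT (@vnorm m : _ -> measurableTypeR R).
Proof. exact: (measurableT_comp measurable_sqrtr (@measurable_sqn m)). Qed.

Lemma measurable_normalize m : measurable_fun setT (@normalize R m).
Proof.
apply: measurable_scalemx => //.
exact: (measurableT_comp measurable_invr (@measurable_vnorm m)).
Qed.

Lemma measurable_gdens m : measurable_fun setT (@gdens R m : _ -> measurableTypeR R).
Proof.
apply: measurable_funM => //.
apply: (measurableT_comp (f := @expR R)) => //.
apply: measurable_funM => //.
by apply: measurableT_comp => //; exact: measurable_sqn.
Qed.

Lemma gdens_ge0 m (v : 'cV[R]_m) : 0 <= gdens v.
Proof. by rewrite mulr_ge0 ?exprn_ge0 ?invr_ge0 ?sqrtr_ge0 ?expR_ge0. Qed.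

Lemma gdens_sqn m (v w : 'cV[R]_m) : sqn v = sqn w -> gdens v = gdens w.
Proof. by rewrite /gdens => ->. Qed.

(** In positive dimension the origin lies in the null hyperplane where the first coordinate is 0. In
    dimension 0 it would be the whole space. *)
Lemma eq_iint_neq0 m (f g : 'cV[R]_m.+1 -> \bar R) :
  (forall v, 0 <= f v)%E -> (forall v, 0 <= g v)%E ->
  measurable_fun setT f -> measurable_fun setT g ->
  (forall v, 0 < sqn v -> f v = g v) -> iint f = iint g.
Proof.
move=> f0 g0 mf mg fg; rewrite !iintS; apply: ge0_ae_eq_integral => //.
- exact: measurable_iint_vcons.
- exact: measurable_iint_vcons.
- by move=> x _; exact: iint_ge0.
- by move=> x _; exact: iint_ge0.
exists [set 0]; split => //; first exact: lebesgue_measure_set1.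
move=> x /= h; apply: contrapT => /eqP x0; apply: h => _.
apply: eq_iint => v; apply: fg; rewrite sqn_vcons.
by rewrite ltr_wpDr ?sqn_ge0// exprn_even_gt0//=.
Qed.

End Scaling.

(** * Closure rules for measurability *)

Section Composition.
Context (R : realType) d (T : measurableType d).
Implicit Types (f g : T -> measurableTypeR R).

Lemma meas_bool (P : T -> bool) : measurable_fun setT P ->
  measurable_fun setT (fun t => (P t)%:R : measurableTypeR R).
Proof.
move=> mP; have -> : (fun t => (P t)%:R) = (fun t => if P t then 1 else 0 : R).
  by apply/funext => t; case: (P t).
exact: measurable_fun_ifT.
Qed.

Lemma meas_le f g : measurable_fun setT f -> measurable_fun setT g ->
  measurable_fun setT (fun t => f t <= g t).
Proof. exact: measurable_fun_ler. Qed.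

Lemma meas_lt f g : measurable_fun setT f -> measurable_fun setT g ->
  measurable_fun setT (fun t => f t < g t).
Proof. exact: measurable_fun_ltr. Qed.

Lemma meas_inv f : measurable_fun setT f ->
  measurable_fun setT (fun t => (f t)^-1 : measurableTypeR R).
Proof. by move=> mf; exact: (measurableT_comp (@measurable_invr R)). Qed.

Lemma meas_sqrt f : measurable_fun setT f ->
  measurable_fun setT (fun t => Num.sqrt (f t) : measurableTypeR R).
Proof. by move=> mf; exact: (measurableT_comp (@measurable_sqrtr R)). Qed.

Lemma meas_expR f : measurable_fun setT f ->
  measurable_fun setT (fun t => expR (f t) : measurableTypeR R).
Proof. by move=> mf; exact: (measurableT_comp (@measurable_expR R)). Qed.

Lemma meas_X f n : measurable_fun setT f ->
  measurable_fun setT (fun t => f t ^+ n : measurableTypeR R).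
Proof. by move=> mf; exact: measurable_funX. Qed.

Lemma meas_EFin f : measurable_fun setT f ->
  measurable_fun setT (fun t => (f t)%:E).
Proof. by move=> mf; exact/measurable_EFinP. Qed.

Lemma meas_fine (f : T -> \bar R) : measurable_fun setT f ->
  measurable_fun setT (fun t => fine (f t) : measurableTypeR R).
Proof. by move=> mf; exact: (measurableT_comp (fine_measurable measurableT)). Qed.

Context (m : nat).
Implicit Types (v : T -> 'cV[R]_m).

Lemma meas_sqn v : measurable_fun setT v ->
  measurable_fun setT (fun t => sqn (v t) : measurableTypeR R).
Proof. by move=> mf; exact: (measurableT_comp (@measurable_sqn R m)). Qed.

Lemma meas_vnorm v : measurable_fun setT v ->
  measurable_fun setT (fun t => vnorm (v t) : measurableTypeR R).
Proof. by move=> mf; exact: (measurableT_comp (@measurable_vnorm R m)). Qed.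

Lemma meas_gdens v : measurable_fun setT v ->
  measurable_fun setT (fun t => gdens (v t) : measurableTypeR R).
Proof. by move=> mf; exact: (measurableT_comp (@measurable_gdens R m)). Qed.

Lemma meas_normalize v : measurable_fun setT v ->
  measurable_fun setT (fun t => normalize (v t)).
Proof. by move=> mf; exact: (measurableT_comp (@measurable_normalize R m)). Qed.

End Composition.

Ltac mstep := first
  [ assumption
  | exact: measurable_id | exact: measurable_cst
  | exact: measurable_fst | exact: measurable_snd
  | exact: (measurableT_comp measurable_fst measurable_fst)
  | exact: (measurableT_comp measurable_snd measurable_fst)
  | apply: meas_EFin | apply: meas_gdens | apply: meas_normalize
  | apply: meas_vnorm | apply: meas_sqn | apply: meas_bool
  | apply: meas_le | apply: meas_lt | apply: measurable_and
  | apply: measurable_scalemx | apply: meas_inv | apply: meas_sqrt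
  | apply: meas_expR | apply: meas_X | apply: measurable_funM
  | apply: measurable_funD | apply: measurable_funB | apply: measurable_funN ].
Ltac msolve := repeat mstep.

(** * Gaussian expectations *)

Section Gauss.
Context (R : realType).
Notation mu := (@lebesgue_measure R).
Implicit Types (m : nat).

Lemma integral_gauss (b : R) : 0 < b ->
  (\int[mu]_x (expR (- b * x ^+ 2))%:E = (Num.sqrt (pi / b))%:E)%E.
Proof.
move=> b0; have sb0 : 0 < Num.sqrt b by rewrite sqrtr_gt0.
have g0 (x : R) : (0 <= (gauss_fun x)%:E)%E by rewrite lee_fin gauss_fun_ge0.
have mg : measurable_fun setT ((fun x => (gauss_fun x)%:E) : measurableTypeR R -> _).
  by rewrite /gauss_fun; msolve.
have := integral_scale sb0 g0 mg; rewrite integralT_gauss.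
move=> h; rewrite sqrtrM ?pi_ge0// sqrtrV ?ltW// EFinM muleC h.
rewrite muleA -EFinM mulVf ?gt_eqF// mul1e.
apply: eq_integral => x _; rewrite /gauss_fun exprMn sqr_sqrtr ?ltW//.
by rewrite mulNr.
Qed.

Lemma iint_gauss m (b : R) : 0 < b ->
  (iint (fun v : 'cV[R]_m => (expR (- b * sqn v))%:E) =
   (Num.sqrt (pi / b) ^+ m)%:E)%E.
Proof.
move=> b0; elim: m => [|m IH].
  by rewrite /= /sqn big_ord0 mulr0 expR0.
rewrite iintS (eq_integral (fun x : measurableTypeR R =>
  ((Num.sqrt (pi / b) ^+ m)%:E * (expR (- b * (x : R) ^+ 2))%:E)%E)); last first.
  move=> x _; rewrite muleC -IH -iintZl ?lee_fin ?expR_ge0//; last first.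
    by msolve.
  by apply: eq_iint => v; rewrite sqn_vcons mulrDr expRD EFinM.
rewrite ge0_integralZl_EFin//; last by msolve.
by rewrite integral_gauss// -EFinM exprSr.
Qed.

Local Open Scope ereal_scope.

Lemma meas_gdensM m (f : 'cV[R]_m -> \bar R) : measurable_fun setT f ->
  measurable_fun setT (fun z => (gdens z)%:E * f z).
Proof. by move=> mf; apply: emeasurable_funM => //; msolve. Qed.

Lemma Egauss_ge0 m (f : 'cV[R]_m -> \bar R) : (forall v, 0 <= f v) -> 0 <= Egauss f.
Proof.
by move=> f0; apply: iint_ge0 => v; rewrite mule_ge0// lee_fin gdens_ge0.
Qed.

Lemma eq_Egauss m (f g : 'cV[R]_m -> \bar R) : f =1 g -> Egauss f = Egauss g.
Proof. by move=> /funext ->. Qed.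

Lemma le_Egauss m (f g : 'cV[R]_m -> \bar R) : (forall v, 0 <= f v) ->
  measurable_fun setT f -> measurable_fun setT g ->
  (forall v, f v <= g v) -> Egauss f <= Egauss g.
Proof.
move=> f0 mf mg fg; apply: le_iint => [v|||v]; try exact: meas_gdensM.
  by rewrite mule_ge0// lee_fin gdens_ge0.
by rewrite lee_pmul// lee_fin gdens_ge0.
Qed.

Lemma EgaussD m (f g : 'cV[R]_m -> \bar R) : (forall v, 0 <= f v) ->
  (forall v, 0 <= g v) -> measurable_fun setT f -> measurable_fun setT g ->
  Egauss (fun v => f v + g v) = Egauss f + Egauss g.
Proof.
move=> f0 g0 mf mg; rewrite /Egauss -iintD; try exact: meas_gdensM.
- by apply: eq_iint => v; rewrite ge0_muleDr.
- by move=> v; rewrite mule_ge0// lee_fin gdens_ge0.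
- by move=> v; rewrite mule_ge0// lee_fin gdens_ge0.
Qed.

Lemma EgaussZl m (f : 'cV[R]_m -> \bar R) k : 0 <= k ->
  (forall v, 0 <= f v) -> measurable_fun setT f ->
  Egauss (fun v => k * f v) = k * Egauss f.
Proof.
move=> k0 f0 mf; rewrite /Egauss -iintZl//; try exact: meas_gdensM.
- by apply: eq_iint => v; rewrite muleCA.
- by move=> v; rewrite mule_ge0// lee_fin gdens_ge0.
Qed.

(** Tilting by [expR (l * sqn z)] leaves a Gaussian integrand of parameter [1/2 - l]. This is the
    Laplace transform of the chi-square law; [l = 0] gives total mass 1. *)
Lemma Egauss_expR m (l : R) : (l < 2^-1)%R ->
  Egauss (fun z : 'cV[R]_m => (expR (l * sqn z))%:E) =
  ((Num.sqrt (1 - 2 * l))^-1 ^+ m)%:E.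
Proof.
move=> l2; have l1 : (0 < 1 - 2 * l)%R by lra.
pose c : R := ((Num.sqrt (2 * pi))^-1 ^+ m)%R.
have c0 : (0 <= c)%R by rewrite exprn_ge0// invr_ge0 sqrtr_ge0.
have b0 : (0 < 2^-1 - l)%R by rewrite subr_gt0.
transitivity (c%:E * iint (fun v : 'cV[R]_m => (expR (- (2^-1 - l) * sqn v))%:E)).
  rewrite -iintZl//; last by msolve.
  apply: eq_iint => v; rewrite -!EFinM /gdens -mulrA -expRD.
  by congr (_ * expR _)%:E; field.
rewrite iint_gauss// -EFinM -exprMn; congr (_ ^+ _)%:E.
have pi0 : (0 < 2 * pi :> R)%R by rewrite mulr_gt0// pi_gt0.
rewrite -(sqrtrV (ltW pi0)) -(sqrtrV (ltW l1)) -sqrtrM ?invr_ge0 ?ltW//.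
congr Num.sqrt; have := pi_gt0 R; move: (pi : R) => p p0.
field; apply/andP; split; apply/eqP; lra.
Qed.

Lemma Egauss1 m : Egauss (fun _ : 'cV[R]_m => 1) = 1.
Proof.
transitivity (Egauss (fun z : 'cV[R]_m => (expR (0 * sqn z))%:E)).
  by apply: eq_Egauss => z; rewrite mul0r expR0.
by rewrite Egauss_expR// mulr0 subr0 sqrtr1 invr1 expr1n.
Qed.

Lemma Egauss_cst m k : 0 <= k -> Egauss (fun _ : 'cV[R]_m => k) = k.
Proof.
move=> k0; rewrite -[RHS]mule1 -(Egauss1 m) -EgaussZl//.
by apply: eq_Egauss => z; rewrite mule1.
Qed.

End Gauss.

(** * Polar coordinates *)

Section Polar.
Context (R : realType).
Implicit Types (m : nat).

Lemma normalizeZ m (s : R) (v : 'cV[R]_m) : 0 < s ->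
  normalize (s *: v) = normalize v.
Proof.
move=> s0; rewrite /normalize sqnZ sqrtrM ?sqr_ge0// sqrtr_sqr gtr0_norm//.
by rewrite invfM scalerA mulrAC mulVf ?mul1r// gt_eqF.
Qed.

Lemma vnormZ m (s : R) (v : 'cV[R]_m) : 0 <= s -> vnorm (s *: v) = s * vnorm v.
Proof.
by move=> s0; rewrite /vnorm sqnZ sqrtrM ?sqr_ge0// sqrtr_sqr ger0_norm.
Qed.

Lemma vnorm_ge0 m (v : 'cV[R]_m) : 0 <= vnorm v.
Proof. exact: sqrtr_ge0. Qed.

Lemma vnorm_gt0 m (v : 'cV[R]_m) : (0 < vnorm v) = (0 < sqn v).
Proof. by rewrite sqrtr_gt0. Qed.

Lemma sqr_vnorm m (v : 'cV[R]_m) : vnorm v ^+ 2 = sqn v.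
Proof. by rewrite sqr_sqrtr// sqn_ge0. Qed.

Lemma scale_normalize m (v : 'cV[R]_m) : vnorm v *: normalize v = v.
Proof.
have [v0|] := boolP (0 < sqn v).
  by rewrite scalerA divff ?scale1r// gt_eqF// vnorm_gt0.
rewrite -leNgt => v0; have /sqn_eq0 -> : sqn v = 0.
  by apply/eqP; rewrite eq_le v0 sqn_ge0.
by rewrite /normalize !scaler0.
Qed.

Definition in_punctured_ball m (u : 'cV[R]_m) : bool := 0 < sqn u <= 1.

(** The absolute Jacobian of the inversion sending [w] to [w / |w|^2], cut off to [|w| >= 1]. Its
    integral is therefore the volume of the unit ball, which [polar] recovers from the case
    [psi = 1] of the next lemma. *)
Definition inversion_weight m (w : 'cV[R]_m) : R := (sqn w)^-1 ^+ m * (1 <= sqn w)%R%:R.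

(* A polar change of variables made only of homotheties and Tonelli: the
   auxiliary weight [|w|^(-2K) 1(|w| >= 1)] is turned, after rescaling first
   [y = |w| u], then [w] by [|u|] and finally [u] by [|w|], into the
   indicator of the unit ball. *)
Lemma polar_aux m (psi : R -> 'cV[R]_m.+1 -> R) :
  (forall t v, 0 <= psi t v) ->
  measurable_fun setT
    (fun p : measurableTypeR R * 'cV[R]_m.+1 => psi p.1 p.2 : measurableTypeR R) ->
  (Egauss (fun z : 'cV[R]_m.+1 => (psi (vnorm z) (normalize z))%:E) *
   iint (fun w : 'cV[R]_m.+1 => (inversion_weight w)%:E) =
   iint (fun u : 'cV[R]_m.+1 => (in_punctured_ball u)%:R%:E *
     Egauss (fun w : 'cV[R]_m.+1 => (psi (vnorm w) (normalize u))%:E)))%E.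
Proof.
move=> psi0 mpsi; set K := m.+1.
have mpsi' d (T : measurableType d) (t : T -> measurableTypeR R) (v : T -> 'cV[R]_K) :
    measurable_fun setT t -> measurable_fun setT v ->
    measurable_fun setT (fun x => psi (t x) (v x) : measurableTypeR R).
  move=> mt mv; apply: (measurableT_comp (f := fun p => psi p.1 p.2)
    (g := fun x => (t x, v x))) => //.
  exact: measurable_fun_pair.
have q0 (w : 'cV[R]_K) : 0 <= inversion_weight w.
  by rewrite mulr_ge0// exprn_ge0// invr_ge0 sqn_ge0.
have mq d (T : measurableType d) (v : T -> 'cV[R]_K) :
    measurable_fun setT v -> measurable_fun setT (fun x => inversion_weight (v x) : measurableTypeR R).
  by move=> mv; rewrite /inversion_weight; msolve.
(* The integrands after each of the three rescalings, Jacobians included. *)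
pose F1 (w u : 'cV[R]_K) := inversion_weight w * vnorm w ^+ K * gdens (vnorm w *: u) *
  psi (vnorm w * vnorm u) (normalize u).
pose F2 (w u : 'cV[R]_K) := (vnorm u)^-1 ^+ K * inversion_weight ((vnorm u)^-1 *: w) *
  (vnorm w / vnorm u) ^+ K * gdens w * psi (vnorm w) (normalize u).
pose F3 (w u : 'cV[R]_K) := (in_punctured_ball u)%:R * (gdens w * psi (vnorm w) (normalize u)).
have inv0 (w : 'cV[R]_K) : 0 <= (vnorm w)^-1 by rewrite invr_ge0 vnorm_ge0.
have F10 w u : 0 <= F1 w u.
  by repeat first [exact: q0|exact: psi0|exact: gdens_ge0|exact: vnorm_ge0
    |exact: inv0|apply: exprn_ge0|apply: mulr_ge0].
have F20 w u : 0 <= F2 w u.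
  by repeat first [exact: q0|exact: psi0|exact: gdens_ge0|exact: vnorm_ge0
    |exact: inv0|apply: exprn_ge0|apply: mulr_ge0].
have F30 w u : 0 <= F3 w u by rewrite !mulr_ge0// gdens_ge0.
have mF1 : measurable_fun setT (fun p : 'cV[R]_K * 'cV[R]_K => (F1 p.1 p.2)%:E).
  rewrite /F1; apply: meas_EFin; apply: measurable_funM; last by apply: mpsi'; msolve.
  by apply: measurable_funM; [apply: measurable_funM; [exact: mq|msolve]|msolve].
have mF2 : measurable_fun setT (fun p : 'cV[R]_K * 'cV[R]_K => (F2 p.1 p.2)%:E).
  rewrite /F2; apply: meas_EFin; apply: measurable_funM; last by apply: mpsi'; msolve.
  apply: measurable_funM; last by msolve.
  apply: measurable_funM; last by msolve.
  by apply: measurable_funM; [msolve|apply: mq; msolve].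
have mF3 : measurable_fun setT (fun p : 'cV[R]_K * 'cV[R]_K => (F3 p.1 p.2)%:E).
  rewrite /F3; apply: meas_EFin; apply: measurable_funM; first by rewrite /in_punctured_ball; msolve.
  by apply: measurable_funM; [msolve|apply: mpsi'; msolve].
have swap (F : 'cV[R]_K -> 'cV[R]_K -> R) :
    measurable_fun setT (fun p : 'cV[R]_K * 'cV[R]_K => (F p.1 p.2)%:E) ->
    measurable_fun setT (fun p : 'cV[R]_K * 'cV[R]_K => (F p.2 p.1)%:E).
  move=> mF; apply: (measurableT_comp (f := fun p => (F p.1 p.2)%:E)
    (g := fun p : 'cV[R]_K * 'cV[R]_K => (p.2, p.1))) => //.
  exact: measurable_fun_pair.
have sec1 (F : 'cV[R]_K -> 'cV[R]_K -> R) w :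
    measurable_fun setT (fun p : 'cV[R]_K * 'cV[R]_K => (F p.1 p.2)%:E) ->
    measurable_fun setT (fun u : 'cV[R]_K => (F w u)%:E).
  by move=> mF; exact: (measurableT_comp mF (pair1_measurable w)).
have marg (F : 'cV[R]_K -> 'cV[R]_K -> R) : (forall w u, 0 <= F w u) ->
    measurable_fun setT (fun p : 'cV[R]_K * 'cV[R]_K => (F p.1 p.2)%:E) ->
    measurable_fun setT (fun w => iint (fun u : 'cV[R]_K => (F w u)%:E)).
  by move=> F0 mF; apply: measurable_iint => // w u; rewrite lee_fin.
have iF0 (F : 'cV[R]_K -> R) : (forall u, 0 <= F u) ->
    (0 <= iint (fun u : 'cV[R]_K => (F u)%:E))%E.
  by move=> F0; apply: iint_ge0 => u; rewrite lee_fin.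
have mgpsi : measurable_fun setT
    (fun z : 'cV[R]_K => (gdens z)%:E * (psi (vnorm z) (normalize z))%:E)%E.
  by apply: meas_gdensM; apply: meas_EFin; apply: mpsi'; msolve.
have gpsi0 (z : 'cV[R]_K) : (0 <= (gdens z)%:E * (psi (vnorm z) (normalize z))%:E)%E.
  by apply: mule_ge0; rewrite lee_fin ?gdens_ge0.
rewrite -iintZl//; last 2 first.
- by apply: Egauss_ge0 => z; rewrite lee_fin.
- by apply: meas_EFin; apply: mq.
transitivity (iint (fun w : 'cV[R]_K => iint (fun u => (F1 w u)%:E))).
  apply: eq_iint => w; rewrite muleC.
  have [w1|w1] := boolP (1 <= sqn w); last first.
    rewrite /inversion_weight (negbTE w1) mulr0 mul0e.
    rewrite -(iint0 R K); apply: eq_iint => u.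
    by rewrite /F1 /inversion_weight (negbTE w1) mulr0 !mul0r.
  have w0 : 0 < vnorm w by rewrite vnorm_gt0; exact: lt_le_trans w1.
  have msc : measurable_fun setT (fun u : 'cV[R]_K => vnorm w *: u).
    by apply: measurable_scalemx => //; exact: measurable_cst.
  rewrite [Egauss _](@iint_scale R K (vnorm w) _ w0 gpsi0 mgpsi).
  rewrite muleA -EFinM -iintZl; first last.
  - exact: (measurableT_comp mgpsi msc).
  - by move=> u; exact: gpsi0.
  - by rewrite lee_fin mulr_ge0 ?q0// exprn_ge0// ltW.
  apply: eq_iint => u; rewrite -!EFinM /F1 normalizeZ// vnormZ ?ltW//.
  by rewrite !mulrA.
rewrite iint_swap//.
transitivity (iint (fun u : 'cV[R]_K => iint (fun w => (F2 w u)%:E))).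
  apply: eq_iint_neq0; try by move=> u; apply: iF0.
  - by apply: (marg (fun u w => F1 w u)) => //; exact: swap.
  - by apply: (marg (fun u w => F2 w u)) => //; exact: swap.
  move=> u; rewrite -vnorm_gt0 => u0.
  have iu0 : 0 < (vnorm u)^-1 by rewrite invr_gt0.
  have mF1u := sec1 (fun u w => F1 w u) u (swap _ mF1).
  have msc : measurable_fun setT (fun w : 'cV[R]_K => (vnorm u)^-1 *: w).
    by apply: measurable_scalemx => //; exact: measurable_cst.
  rewrite (iint_scale iu0 (fun w => F10 w u : (0 <= (F1 w u)%:E)%E) mF1u) -iintZl; first last.
  - exact: (measurableT_comp mF1u msc).
  - by move=> w; rewrite lee_fin.
  - by rewrite lee_fin exprn_ge0// ltW.
  apply: eq_iint => w; rewrite -EFinM /F1 /F2 vnormZ ?ltW//.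
  (* Both vectors have norm [|w|] and the density is radial: from here on the radius is carried by
     [w] and the direction by [u]. *)
  rewrite (@gdens_sqn _ _ ((vnorm u)^-1 * vnorm w *: u) w); last first.
    by rewrite sqnZ exprMn exprVn !sqr_vnorm mulrAC mulVf ?mul1r// gt_eqF// -vnorm_gt0.
  rewrite [_ / vnorm u]mulrC [_ * vnorm w * _]mulrAC mulVf ?gt_eqF// mul1r.
  by rewrite !mulrA.
rewrite -iint_swap//.
transitivity (iint (fun w : 'cV[R]_K => iint (fun u => (F3 w u)%:E))).
  apply: eq_iint_neq0; try by move=> u; apply: iF0.
  - exact: marg.
  - exact: marg.
  move=> w; rewrite -vnorm_gt0 => w0.
  have mF2w := sec1 F2 w mF2.
  have msc : measurable_fun setT (fun u : 'cV[R]_K => vnorm w *: u).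
    by apply: measurable_scalemx => //; exact: measurable_cst.
  rewrite (iint_scale w0 (fun u => F20 w u : (0 <= (F2 w u)%:E)%E) mF2w) -iintZl; first last.
  - exact: (measurableT_comp mF2w msc).
  - by move=> u; rewrite lee_fin.
  - by rewrite lee_fin exprn_ge0// ltW.
  apply: eq_iint => u; rewrite -EFinM /F2 /F3 normalizeZ// vnormZ ?ltW//.
  congr EFin; move: (gdens w) (psi _ _) => G P; rewrite !mulrA; congr (_ * _ * _).
  have sw0 : 0 < sqn w by rewrite -vnorm_gt0.
  (* The rescaled [w] has norm [1 / |u|], so the cutoff becomes [|u| <= 1]. *)
  rewrite /inversion_weight (_ : sqn (_ *: w) = (sqn u)^-1); last first.
    by rewrite sqnZ exprVn exprMn !sqr_vnorm invfM mulrAC mulVf ?mul1r// gt_eqF.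
  (* At [u = 0] the convention [0^-1 = 0] makes the cutoff fail, in agreement with the punctured
     ball. *)
  rewrite /in_punctured_ball; have [u0|] := boolP (0 < sqn u); last first.
    rewrite -leNgt => u0; have -> : sqn u = 0.
      by apply/eqP; rewrite eq_le u0 sqn_ge0.
    by rewrite invr0 ler10 /= !mulr0 !mul0r.
  rewrite invrK invf_ge1//.
  rewrite -(sqr_vnorm u) in u0 *; move: u0; rewrite exprn_even_gt0//= => u0.
  case: (_ <= 1); rewrite ?mulr0 ?mul0r// !mulr1.
  rewrite -!exprMn -[RHS](expr1n _ K); congr (_ ^+ _); field.
  by rewrite u0 gt_eqF.
rewrite iint_swap//.
apply: eq_iint => u; rewrite -iintZl; first last.
- by apply: meas_gdensM; apply: meas_EFin; apply: mpsi'; [msolve|exact: measurable_cst].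
- by move=> w; apply: mule_ge0; rewrite lee_fin ?gdens_ge0.
- by rewrite lee_fin.
by apply: eq_iint => w; rewrite /F3 !EFinM.
Qed.

End Polar.

(** * The uniform law on the sphere as a cone measure *)

Section Sphere.
Context (R : realType).
Notation mu := (@lebesgue_measure R).
Implicit Types (m : nat).
Local Open Scope ereal_scope.

Lemma iint_ball_lty m :
  iint (fun v : 'cV[R]_m => (sqn v <= 1)%R%:R%:E) < +oo.
Proof.
(* The indicator of the ball is at most [expR ((1 - |v|^2) / 2)], whose integral is known. *)
apply: (@le_lt_trans _ _ (iint (fun v : 'cV[R]_m =>
  (expR 2^-1)%:E * (expR (- 2^-1 * sqn v))%:E))); last first.
  rewrite iintZl; first by rewrite iint_gauss ?invr_gt0// -EFinM ltry.
  - by rewrite lee_fin expR_ge0.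
  - by move=> v; rewrite lee_fin expR_ge0.
  - by msolve.
apply: le_iint => [v|||v].
- by rewrite lee_fin ler0n.
- by msolve.
- by apply: emeasurable_funM; msolve.
- rewrite -EFinM lee_fin -expRD.
  have [v1|_] := boolP (sqn v <= 1)%R; last exact: expR_ge0.
  by rewrite -[leLHS]expR0 ler_expR; lra.
Qed.

(** The radius is generalized for the induction: the ball of squared radius [e] contains the product
    of a segment of length [sqrt (e / 2)] with a lower-dimensional ball of squared radius
    [e / 2]. *)
Lemma iint_ball_gt0 m (e : R) : (0 < e)%R ->
  0 < iint (fun v : 'cV[R]_m => (sqn v <= e)%R%:R%:E).
Proof.
elim: m e => [|m IH] e e0.
  by rewrite /= /sqn big_ord0 (ltW e0) lte_fin.
have e20 : (0 < e / 2)%R by rewrite divr_gt0.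
pose c := iint (fun v : 'cV[R]_m => (sqn v <= e / 2)%R%:R%:E).
pose a : R := Num.sqrt (e / 2).
have a0 : (0 < a)%R by rewrite sqrtr_gt0.
rewrite iintS; apply: (@lt_le_trans _ _
    (\int[mu]_x (c * (\1_`[0%R, a] x)%:E))).
  rewrite ge0_integralZl//; first last.
  - by apply: ltW; exact: IH.
  - by apply/measurable_EFinP; exact: measurable_indic.
  have mua : mu `[0%R, a]%classic = a%:E.
    by rewrite lebesgue_measure_itv/= lte_fin a0 -EFinB subr0.
  rewrite integral_indic// setIT [X in _ * X](_ : _ = a%:E); last exact: mua.
  by rewrite mule_gt0// ?lte_fin// IH.
apply: ge0_le_integral => //.
- by move=> x _; rewrite mule_ge0// ?lee_fin// ltW// IH.
- by apply: emeasurable_funM => //; exact/measurable_EFinP.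
- apply: (measurable_iint_vcons (f := fun v => (sqn v <= e)%R%:R%:E)) => //.
  by msolve.
move=> x _; rewrite indicE; have [|xa] := boolP (x \in _); last first.
  by rewrite mule0; apply: iint_ge0 => v; rewrite lee_fin.
rewrite inE/= in_itv/= => /andP[x0 xa]; rewrite mule1.
apply: le_iint => [v|||v]; try by rewrite lee_fin.
- by msolve.
- apply: meas_EFin; apply: meas_bool; apply: meas_le; last by msolve.
  by apply: meas_sqn; apply: measurable_vcons; msolve.
rewrite lee_fin sqn_vcons; have [ve|_] := boolP (sqn v <= e / 2)%R => //=.
have : (x ^+ 2 <= a ^+ 2)%R by rewrite ler_sqr ?nnegrE// ltW.
rewrite (sqr_sqrtr (ltW e20)) => xe.
by suff -> : (x ^+ 2 + sqn v <= e)%R by []; lra.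
Qed.

Lemma ballvol_gt0 m : (0 < @ballvol R m)%R.
Proof.
rewrite /ballvol (eq_iint (g := fun v => (sqn v <= 1)%R%:R%:E)); last first.
  by move=> v; case: ifP.
by rewrite fine_gt0// iint_ball_lty iint_ball_gt0.
Qed.

Lemma meas_in_punctured_ball m :
  measurable_fun setT (fun v : 'cV[R]_m => (in_punctured_ball v)%:R%:E : \bar R).
Proof. by rewrite /in_punctured_ball; msolve. Qed.

Lemma iint_punctured_ball m :
  iint (fun v : 'cV[R]_m.+1 => (in_punctured_ball v)%:R%:E) =
  (@ballvol R m.+1)%:E.
Proof.
transitivity (iint (fun v : 'cV[R]_m.+1 => (sqn v <= 1)%R%:R%:E)).
  apply: eq_iint_neq0 => [v|v|||v v0]; try by rewrite lee_fin.
  - exact: meas_in_punctured_ball.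
  - by msolve.
  - by rewrite /in_punctured_ball v0.
rewrite /ballvol fineK.
  by apply: eq_iint => v; case: ifP.
rewrite (eq_iint (g := fun v => (sqn v <= 1)%R%:R%:E)); last first.
  by move=> v; case: ifP.
by rewrite ge0_fin_numE ?iint_ball_lty// iint_ge0// => v; rewrite lee_fin.
Qed.

Lemma EsphE m (h : 'cV[R]_m -> \bar R) : Esph h =
  (ballvol R m)^-1%:E *
  iint (fun v => (in_punctured_ball v)%:R%:E * h (normalize v)).
Proof.
rewrite /Esph; congr (_ * _); apply: eq_iint => v; rewrite /in_punctured_ball.
by case: ifP => _; rewrite ?mul1e ?mul0e.
Qed.

Lemma meas_ball_normalize m (h : 'cV[R]_m -> \bar R) : measurable_fun setT h ->
  measurable_fun setT (fun v => (in_punctured_ball v)%:R%:E * h (normalize v)).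
Proof.
move=> mh; apply: emeasurable_funM; first exact: meas_in_punctured_ball.
exact: (measurableT_comp mh (@measurable_normalize R m)).
Qed.

Lemma Esph_ge0 m (h : 'cV[R]_m -> \bar R) : (forall v, 0 <= h v) -> 0 <= Esph h.
Proof.
move=> h0; rewrite EsphE mule_ge0//.
  by rewrite lee_fin invr_ge0 ltW// ballvol_gt0.
by apply: iint_ge0 => v; rewrite mule_ge0// lee_fin.
Qed.

Lemma EsphD m (f g : 'cV[R]_m -> \bar R) : (forall v, 0 <= f v) ->
  (forall v, 0 <= g v) -> measurable_fun setT f -> measurable_fun setT g ->
  Esph (fun v => f v + g v) = Esph f + Esph g.
Proof.
move=> f0 g0 mf mg; have b0 v : 0 <= (@in_punctured_ball R m v)%:R%:E by rewrite lee_fin.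
rewrite !EsphE -ge0_muleDr ?iint_ge0//; try by move=> v; rewrite mule_ge0.
rewrite -iintD; try exact: meas_ball_normalize; try by move=> v; rewrite mule_ge0.
by congr (_ * _); apply: eq_iint => v; rewrite ge0_muleDr.
Qed.

Lemma EsphZl m (f : 'cV[R]_m -> \bar R) k : 0 <= k ->
  (forall v, 0 <= f v) -> measurable_fun setT f ->
  Esph (fun v => k * f v) = k * Esph f.
Proof.
move=> k0 f0 mf; rewrite !EsphE muleCA; congr (_ * _).
rewrite -iintZl//; try exact: meas_ball_normalize.
- by apply: eq_iint => v; rewrite muleCA.
- by move=> v; rewrite mule_ge0// lee_fin.
Qed.

Lemma Esph_cst m k : 0 <= k -> Esph (fun _ : 'cV[R]_m.+1 => k) = k.
Proof.
move=> k0; rewrite EsphE (eq_iint (g := fun v => k * (in_punctured_ball v)%:R%:E)).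
  rewrite iintZl//; last exact: meas_in_punctured_ball.
  by rewrite iint_punctured_ball muleCA -EFinM mulVf ?mule1// gt_eqF// ballvol_gt0.
by move=> v; rewrite muleC.
Qed.

(** The direction of a Gaussian vector is uniform and independent of its norm. This is the identity
    [polar_aux] divided by its own case [psi = 1]. *)
Lemma polar m (psi : R -> 'cV[R]_m.+1 -> R) :
  (forall t v, 0 <= psi t v)%R ->
  measurable_fun setT
    (fun p : measurableTypeR R * 'cV[R]_m.+1 => psi p.1 p.2 : measurableTypeR R) ->
  Egauss (fun z : 'cV[R]_m.+1 => (psi (vnorm z) (normalize z))%:E) =
  Esph (fun u : 'cV[R]_m.+1 =>
    Egauss (fun w : 'cV[R]_m.+1 => (psi (vnorm w) u)%:E)).
Proof.
move=> psi0 mpsi; rewrite EsphE -polar_aux// muleCA.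
have := @polar_aux R m (fun _ _ => 1%R) (fun _ _ => ler01).
rewrite Egauss1 mul1e => ->; last exact: measurable_cst.
rewrite (eq_iint (g := fun v => (in_punctured_ball v)%:R%:E)); last first.
  by move=> v; rewrite mule1.
by rewrite iint_punctured_ball -EFinM mulVf ?mule1// gt_eqF// ballvol_gt0.
Qed.

End Sphere.

(** * Concentration of the Gaussian norm *)

Section Concentration.
Context (R : realType).
Implicit Types (m : nat) (l u p q k : R).

Lemma sqr_le_expRDN u : u ^+ 2 <= 4 * (expR u + expR (- u)).
Proof.
wlog u0 : u / 0 <= u.
  move=> h; have [/h//|/ltW u0] := leP 0 u.
  have := h (- u); rewrite oppr_ge0 sqrrN opprK addrC; exact.
have h : (1 + u / 2) ^+ 2 <= expR u.
  rewrite (_ : expR u = expR (u / 2) ^+ 2).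
    by rewrite ler_sqr ?nnegrE ?expR_ge0 ?expR_ge1Dx//; lra.
  by rewrite -expRM_natl; congr expR; field.
by have := expR_ge0 (- u); nra.
Qed.

(** The left side is [E (exp (l (X^2 - 1)))] for a standard normal X. Since [(1 - 2 l) (1 + 2 l + 8
    l^2) = 1 + 4 l^2 (1 - 4 l)], the condition [l <= 1/4] gives
    [1 / (1 - 2 l) <= exp (2 l + 8 l^2)]; then take square roots. *)
Lemma laplace_factor_le l : l <= 4^-1 ->
  expR (- l) * (Num.sqrt (1 - 2 * l))^-1 <= expR (4 * l ^+ 2).
Proof.
move=> l4; have l1 : 0 < 1 - 2 * l by lra.
have h : expR (- (2 * l + 8 * l ^+ 2)) <= 1 - 2 * l.
  rewrite expRN invf_ple ?posrE ?expR_gt0//.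
  apply: (le_trans _ (expR_ge1Dx _)).
  by rewrite -[leLHS]div1r ler_pdivrMr//; nra.
have {}h : expR (- (l + 4 * l ^+ 2)) <= Num.sqrt (1 - 2 * l).
  rewrite -ler_sqr ?nnegrE ?expR_ge0 ?sqrtr_ge0// (sqr_sqrtr (ltW l1)).
  by rewrite -expRM_natl; apply: le_trans h; rewrite ler_expR; lra.
rewrite (_ : 4 * l ^+ 2 = - l + (l + 4 * l ^+ 2)); last by ring.
rewrite [leRHS]expRD ler_pM2l ?expR_gt0//.
by rewrite invf_ple ?posrE ?expR_gt0 ?sqrtr_gt0// -expRN.
Qed.

(** [128 = 2 * 4 * 16]: two exponentials of opposite sign, the factor 4 of [sqr_le_expRDN], and
    [16 K = 1 / l^2] for the exponent [l] chosen below. The factor [expR 4^-1] bounds the K-fold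
    product of Laplace factors. *)
Definition moment_cst : R := 128 * expR 4^-1.

Lemma moment_cst_ge0 : 0 <= moment_cst.
Proof. by rewrite mulr_ge0 ?expR_ge0. Qed.

Local Open Scope ereal_scope.

(* The fourth Gaussian moment is replaced by an exponential one, for which
   homotheties suffice. *)
Lemma Egauss_sqn_dev m :
  Egauss (fun w : 'cV[R]_m.+1 => ((sqn w - m.+1%:R) ^+ 2)%R%:E) <=
  (moment_cst * m.+1%:R)%:E.
Proof.
set K : R := m.+1%:R; have K0 : (0 < K)%R by rewrite ltr0n.
have K1 : (1 <= K)%R by rewrite ler1n.
set k := Num.sqrt K; have k0 : (0 < k)%R by rewrite sqrtr_gt0.
have kk : (k ^+ 2 = K)%R by rewrite sqr_sqrtr// ltW.
have k1 : (1 <= k)%R by rewrite -sqrtr1 ler_sqrt.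
(* With this choice [4 l^2 K = 1/4], so the product of K factors [expR (4 l^2)] does not depend on
   K, and [l <= 1/4]. *)
pose l : R := ((4 * k)^-1)%R.
have l0 : (0 < l)%R by rewrite invr_gt0 mulr_gt0.
have l4 : (l <= 4^-1)%R by rewrite lef_pV2 ?posrE//; lra.
have l2K : (4 * l ^+ 2 * K = 4^-1)%R by rewrite -kk /l; field; rewrite gt_eqF.
have tail (e : R) : (e <= 4^-1)%R -> (e ^+ 2 = l ^+ 2)%R ->
    Egauss (fun w : 'cV[R]_m.+1 => (64 * K * expR (- e * K))%:E * (expR (e * sqn w))%:E)
    <= (64 * K * expR 4^-1)%:E.
  move=> e4 e2; have c0 : (0 <= 64 * K * expR (- e * K))%R.
    by rewrite !mulr_ge0// ?expR_ge0// ltW.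
  rewrite EgaussZl//; last by msolve.
  rewrite Egauss_expR; last by lra.
  rewrite -EFinM lee_fin -!mulrA ler_pM2l// ler_pM2l//.
  rewrite -l2K -e2 /K !expRM_natr -exprMn.
  by rewrite lerXn2r ?nnegrE ?expR_ge0 ?mulr_ge0 ?invr_ge0 ?sqrtr_ge0 ?laplace_factor_le.
apply: (@le_trans _ _ (Egauss (fun w : 'cV[R]_m.+1 =>
   (64 * K * expR (- l * K))%:E * (expR (l * sqn w))%:E +
   (64 * K * expR (- - l * K))%:E * (expR (- l * sqn w))%:E))).
  apply: le_Egauss => [w|||w].
  - by rewrite lee_fin sqr_ge0.
  - by msolve.
  - by apply: emeasurable_funD; apply: emeasurable_funM; msolve.
  rewrite -!EFinM -EFinD lee_fin -!mulrA -!expRD -!mulrDr.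
  have := sqr_le_expRDN (l * (sqn w - K)).
  rewrite exprMn (_ : - l * K + l * sqn w = l * (sqn w - K))%R; last by ring.
  rewrite (_ : - - l * K + - l * sqn w = - (l * (sqn w - K)))%R; last by ring.
  have e1 : ((sqn w - K) ^+ 2 = (16 * K) * (l ^+ 2 * (sqn w - K) ^+ 2))%R.
    by rewrite -kk /l; field; rewrite gt_eqF.
  move=> h; rewrite [leLHS]e1 [leRHS](_ : _ = 16 * K * (4 *
    (expR (l * (sqn w - K)) + expR (- (l * (sqn w - K))))))%R; last by ring.
  by rewrite ler_pM2l// mulr_gt0.
rewrite EgaussD; first last.
- by apply: emeasurable_funM; msolve.
- by apply: emeasurable_funM; msolve.
- by move=> w; rewrite -EFinM lee_fin !mulr_ge0// ?expR_ge0// ltW.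
- by move=> w; rewrite -EFinM lee_fin !mulr_ge0// ?expR_ge0// ltW.
apply: (le_trans (leeD (tail l l4 erefl) (tail (- l)%R _ _))); first by lra.
  by rewrite sqrrN.
by rewrite -EFinD lee_fin /moment_cst; lra.
Qed.

(** If [p <= k^2 / 2], the deviation of [p] alone exceeds the bound 1. Otherwise [1 - a <= 1 - a^2 =
    (p - q) / p <= 2 (p - q) / k^2], and [2 k (p - q) <= (p - q)^2 + k^2] trades the linear term for
    squares, the only moments available, at the price of [1 / k]. *)
Lemma radii_ratio_le k p q : (0 < k)%R -> (0 <= p)%R -> (0 <= q)%R ->
  (Num.max 0 (1 - Num.sqrt q / Num.sqrt p) <=
   (4 / k ^+ 4 + 2 / k ^+ 3) * (p - k ^+ 2) ^+ 2 +
   2 / k ^+ 3 * (q - k ^+ 2) ^+ 2 + k^-1)%R.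
Proof.
move=> k0 p0 q0; set a := (Num.sqrt q / Num.sqrt p)%R.
have a0 : (0 <= a)%R by rewrite divr_ge0 ?sqrtr_ge0.
have c1 : (0 <= 4 / k ^+ 4 * (p - k ^+ 2) ^+ 2)%R.
  by rewrite mulr_ge0 ?sqr_ge0// divr_ge0 ?exprn_ge0 ?ltW.
have c2 x : (0 <= 2 / k ^+ 3 * (x - k ^+ 2) ^+ 2)%R.
  by rewrite mulr_ge0 ?sqr_ge0// divr_ge0 ?exprn_ge0 ?ltW.
have ik0 : (0 < k^-1)%R by rewrite invr_gt0.
rewrite mulrDl ge_max; apply/andP; split.
  by rewrite !addr_ge0// ltW.
have [pk|pk] := leP p (k ^+ 2 / 2)%R.
  apply: (@le_trans _ _ (4 / k ^+ 4 * (p - k ^+ 2) ^+ 2)%R); last first.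
    by have := c2 p; have := c2 q; lra.
  apply: (@le_trans _ _ 1%R); first by lra.
  rewrite mulrAC ler_pdivlMr ?exprn_gt0// mul1r.
  have k2 : (0 < k ^+ 2)%R by rewrite exprn_gt0.
  rewrite (exprM k 2 2); move: (k ^+ 2)%R k2 pk => b b0 pb.
  (* The product equals [4 (p - b)^2 - b^2]. *)
  have : (0 <= (b - 2 * p) * (3 * b - 2 * p))%R by rewrite mulr_ge0//; lra.
  by nra.
have pp : (0 < p)%R by apply: le_lt_trans pk; rewrite divr_ge0 ?exprn_ge0 ?ltW.
have a2 : (a ^+ 2 = q / p)%R by rewrite expr_div_n !sqr_sqrtr.
have [a1|a1] := leP 1%R a.
  by have := c2 p; have := c2 q; lra.
apply: (@le_trans _ _ (2 / k ^+ 2 * (p - q))%R).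
  apply: (@le_trans _ _ (1 - a ^+ 2)%R); first by nra.
  rewrite [leLHS](_ : _ = p^-1 * (p - q))%R; last first.
    by rewrite a2; field; rewrite gt_eqF.
  rewrite ler_wpM2r//.
    rewrite subr_ge0 -[leRHS]mul1r -ler_pdivrMr// -a2.
    by rewrite expr_le1// ltW.
  rewrite -[leLHS]div1r ler_pdivrMr// mulrAC ler_pdivlMr ?exprn_gt0//; lra.
apply: (@le_trans _ _ (2 / k ^+ 3 * (p - k ^+ 2) ^+ 2 +
   2 / k ^+ 3 * (q - k ^+ 2) ^+ 2 + k^-1)%R); last by lra.
have -> : (2 / k ^+ 2 * (p - q) = k^-1 ^+ 3 * (2 * k * (p - q)))%R.
  by field; rewrite gt_eqF.
have -> : (2 / k ^+ 3 * (p - k ^+ 2) ^+ 2 + 2 / k ^+ 3 * (q - k ^+ 2) ^+ 2 + k^-1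
   = k^-1 ^+ 3 * (2 * (p - k ^+ 2) ^+ 2 + 2 * (q - k ^+ 2) ^+ 2 + k ^+ 2))%R.
  by field; rewrite gt_eqF.
rewrite ler_pM2l ?exprn_gt0//.
have := sqr_ge0 (p - q - k); have := sqr_ge0 (p + q - 2 * k ^+ 2).
by nra.
Qed.

(** Each squared deviation integrates to at most [M K], with [M] the moment constant. For [K = k^2]
    the total is [4 M / k^2 + (4 M + 1) / k], and [k >= 1] merges the two terms. *)
Lemma Egauss_radii_ratio m :
  Egauss (fun z : 'cV[R]_m.+1 => Egauss (fun w : 'cV[R]_m.+1 =>
    (Num.max 0 (1 - vnorm z / vnorm w))%R%:E)) <=
  ((8 * moment_cst + 1) / Num.sqrt m.+1%:R)%:E.
Proof.
set K : R := m.+1%:R; have K0 : (0 < K)%R by rewrite ltr0n.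
set k := Num.sqrt K; have k0 : (0 < k)%R by rewrite sqrtr_gt0.
have kk : (k ^+ 2 = K)%R by rewrite sqr_sqrtr// ltW.
have K1 : (1 <= K)%R by rewrite ler1n.
have k1 : (1 <= k)%R by rewrite -sqrtr1 ler_sqrt.
have ik0 : (0 < k^-1)%R by rewrite invr_gt0.
have M0 := moment_cst_ge0.
pose c1 : R := (4 / k ^+ 4 + 2 / k ^+ 3)%R.
pose c2 : R := (2 / k ^+ 3)%R.
have c20 : (0 <= c2)%R by rewrite divr_ge0// exprn_ge0// ltW.
have c10 : (0 <= c1)%R by rewrite addr_ge0// divr_ge0// exprn_ge0// ltW.
have md : measurable_fun setT (fun w : 'cV[R]_m.+1 => ((sqn w - K) ^+ 2)%R%:E).
  by msolve.
have d0 (w : 'cV[R]_m.+1) : 0 <= ((sqn w - K) ^+ 2)%R%:E by rewrite lee_fin sqr_ge0.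
have affine (a b : R) : (0 <= a)%R -> (0 <= b)%R ->
    Egauss (fun w : 'cV[R]_m.+1 => a%:E * ((sqn w - K) ^+ 2)%R%:E + b%:E) <=
    (a * (moment_cst * K) + b)%:E.
  move=> a0 b0; rewrite EgaussD//; first last.
  - exact: emeasurable_funM.
  - by move=> w; rewrite mule_ge0.
  rewrite Egauss_cst ?lee_fin// EgaussZl ?lee_fin// EFinD EFinM.
  by rewrite leeD// lee_wpmul2l ?lee_fin// Egauss_sqn_dev.
apply: (@le_trans _ _ (Egauss (fun z : 'cV[R]_m.+1 =>
   c2%:E * ((sqn z - K) ^+ 2)%R%:E + (c1 * (moment_cst * K) + k^-1)%:E))).
  apply: le_Egauss => [z|||z].
  - by apply: Egauss_ge0 => w; rewrite lee_fin le_max lexx.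
  - apply: (measurable_iint (f := fun z w =>
      (gdens w)%:E * (Num.max 0 (1 - vnorm z / vnorm w))%R%:E)) => [z w|].
      by rewrite -EFinM lee_fin mulr_ge0 ?gdens_ge0// le_max lexx.
    apply: emeasurable_funM; first by msolve.
    by apply: meas_EFin; apply: measurable_maxr; msolve.
  - by apply: emeasurable_funD => //; apply: emeasurable_funM.
  apply: (@le_trans _ _ (Egauss (fun w : 'cV[R]_m.+1 =>
     c1%:E * ((sqn w - K) ^+ 2)%R%:E + (c2 * (sqn z - K) ^+ 2 + k^-1)%:E))).
    apply: le_Egauss => [w|||w].
    - by rewrite lee_fin le_max lexx.
    - by apply: meas_EFin; apply: measurable_maxr; msolve.
    - by apply: emeasurable_funD => //; apply: emeasurable_funM.
    rewrite -EFinM -EFinD lee_fin addrA -kk.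
    by apply: radii_ratio_le => //; exact: sqn_ge0.
  apply: le_trans (affine _ _ _ _) _ => //.
    by apply: addr_ge0; [rewrite mulr_ge0 ?sqr_ge0|exact: ltW].
  by rewrite -EFinM -EFinD lee_fin addrCA.
apply: le_trans (affine _ _ _ _) _ => //.
  by apply: addr_ge0; [rewrite !mulr_ge0// ltW|exact: ltW].
rewrite lee_fin /c1 /c2 -kk.
have -> : (2 / k ^+ 3 * (moment_cst * k ^+ 2) +
  ((4 / k ^+ 4 + 2 / k ^+ 3) * (moment_cst * k ^+ 2) + k^-1) =
  4 * moment_cst * k^-1 * k^-1 + (4 * moment_cst + 1) * k^-1)%R.
  by field; rewrite gt_eqF.
have ik1 : (k^-1 <= 1)%R by rewrite invf_le1.
rewrite [leRHS](_ : _ = 4 * moment_cst * k^-1 * 1 + (4 * moment_cst + 1) * k^-1)%R.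
  by rewrite lerD2r ler_wpM2l ?mulr_ge0// ltW.
by field; rewrite gt_eqF.
Qed.

End Concentration.

(** * Star-shaped cylinders *)

Section StarShaped.
Context (R : realType).
Notation mu := (@lebesgue_measure R).

Definition stretch (r : nat) (s : R) : nat -> R := fun i => if (i < r)%N then s else 1.

Lemma dscaleZ m d (c : R) (z : 'cV[R]_m) : dscale d (c *: z) = c *: dscale d z.
Proof. by apply/colP => i; rewrite !mxE mulrCA. Qed.

Lemma sqn_stretch_ge m r s (z : 'cV[R]_m) : 1 <= s ->
  sqn z <= sqn (dscale (stretch r s) z).
Proof.
move=> s1; apply: ler_sum => i _; rewrite mxE exprMn ler_peMl ?sqr_ge0//.
by rewrite /stretch; case: ifP => _; rewrite ?expr1n// exprn_ege1.
Qed.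

Local Open Scope ereal_scope.

(** The Jacobian is [s ^ r], at most [2 ^ r], and for [s >= 1] stretching moves points away from 0,
    where the density is smaller. *)
Lemma Egauss_stretch m r s (f : 'cV[R]_m -> \bar R) : (r <= m)%N ->
  (1 <= s <= 2)%R -> (forall z, 0 <= f z) -> measurable_fun setT f ->
  Egauss f <= (2 ^+ r)%:E * Egauss (f \o dscale (stretch r s)).
Proof.
move=> rm /andP[s1 s2] f0 mf; have s0 : (0 < s)%R by exact: lt_le_trans s1.
have d0 i : (0 < stretch r s i)%R by rewrite /stretch; case: ifP.
have ms := @measurable_dscale R m (stretch r s).
have mg := meas_gdensM mf.
have g0 v : 0 <= (gdens v)%:E * f v by apply: mule_ge0; rewrite ?lee_fin ?gdens_ge0.
rewrite {1}/Egauss (iint_dscale d0 g0 mg) lee_pmul//.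
- by rewrite lee_fin prodr_ge0// => i _; exact: ltW.
- by apply: iint_ge0 => v; exact: g0.
- rewrite lee_fin.
  have -> : (\prod_(i < m) stretch r s i = s ^+ r)%R.
    rewrite -[in RHS](card_ord r) -prodr_const (big_ord_widen _ (fun=> s) rm).
    by rewrite [RHS]big_mkcond; apply: eq_bigr => i _.
  by rewrite lerXn2r ?nnegrE// ltW.
apply: le_iint => [v|||v].
- exact: g0.
- exact: (measurableT_comp mg ms).
- exact: (meas_gdensM (measurableT_comp mf ms)).
apply: lee_wpmul2r => //; rewrite lee_fin /gdens ler_wpM2l ?exprn_ge0 ?invr_ge0 ?sqrtr_ge0//.
by rewrite ler_expR ler_pM2r ?invr_gt0// lerN2 sqn_stretch_ge.
Qed.

Lemma measurable_Egauss d (T : measurableType d) m (f : T -> 'cV[R]_m -> \bar R) :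
  (forall t v, 0 <= f t v) ->
  measurable_fun setT (fun p : T * 'cV[R]_m => f p.1 p.2) ->
  measurable_fun setT (fun t => Egauss (f t)).
Proof.
move=> f0 mf; apply: (measurable_iint (f := fun t v => (gdens v)%:E * f t v)).
  by move=> t v; apply: mule_ge0 => //; rewrite lee_fin gdens_ge0.
by apply: emeasurable_funM => //; msolve.
Qed.

Lemma integral_Egauss m (f : measurableTypeR R -> 'cV[R]_m -> \bar R) :
  (forall s v, 0 <= f s v) ->
  measurable_fun setT (fun p : measurableTypeR R * 'cV[R]_m => f p.1 p.2) ->
  \int[mu]_s Egauss (f s) = Egauss (fun v => \int[mu]_s f s v).
Proof.
move=> f0 mf; rewrite /Egauss iint_integral_swap.
- apply: eq_iint => v; rewrite ge0_integralZl_EFin ?gdens_ge0//.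
  exact: (measurableT_comp mf (pair2_measurable v)).
- by move=> s v; apply: mule_ge0 => //; rewrite lee_fin gdens_ge0.
- by apply: emeasurable_funM => //; msolve.
Qed.

Context (m r : nat) (D : 'cV[R]_m.+1 -> bool).
Hypothesis rm : (r <= m.+1)%N.
Hypothesis mD : measurable_fun setT D.
Hypothesis starD : forall (t : R) z, (0 <= t <= 1)%R -> D z -> D (t *: z).
(** The cylinder property in the form in which it is applied: dilating the first r coordinates or
    all of them has the same effect on membership. *)
Hypothesis cylD : forall (s : R) z, (0 < s)%R ->
  D (dscale (stretch r s) z) = D (s *: z).

Lemma meas_D d (T : measurableType d) (v : T -> 'cV[R]_m.+1) :
  measurable_fun setT v -> measurable_fun setT (fun t => D (v t)).
Proof. by move=> mv; exact: (measurableT_comp mD). Qed.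

(** The event of [Egauss_escape] at the stretched point, with the norm of that point replaced by
    [|z|]. This enlarges the event and reduces [s] to a dilation factor along the fixed ray of
    [z]. *)
Let escape (s : R) (z w : 'cV[R]_m.+1) : bool :=
  [&& (1 <= s <= 2)%R, D (s *: z) & ~~ D ((s * (vnorm w / vnorm z)) *: z)].

Let meas_escape d (T : measurableType d) (s : T -> measurableTypeR R)
    (z w : T -> 'cV[R]_m.+1) :
  measurable_fun setT s -> measurable_fun setT z -> measurable_fun setT w ->
  measurable_fun setT (fun t => (escape (s t) (z t) (w t))%:R%:E : \bar R).
Proof.
move=> ms mz mw; apply: meas_EFin; apply: meas_bool.
apply: measurable_and; first by msolve.
apply: measurable_and; first by apply: meas_D; msolve.
by apply: measurable_neg; apply: meas_D; msolve.
Qed.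

(* On a ray, the [s] in [1, 2] for which [s z] is in [D] while
   [s (|w| / |z|) z] is not lie in an interval [b |z| / |w|, b] with [b <= 2]. *)
Lemma integral_escape z w :
  \int[mu]_s (escape s z w)%:R%:E <= 2%:E * (Num.max 0 (1 - vnorm z / vnorm w))%R%:E.
Proof.
set l := (vnorm w / vnorm z)%R.
have M0 : (0 <= Num.max 0 (1 - vnorm z / vnorm w))%R by rewrite le_max lexx.
have zero : (forall s, ~~ escape s z w) ->
    \int[mu]_s (escape s z w)%:R%:E <= 2%:E * (Num.max 0 (1 - vnorm z / vnorm w))%R%:E.
  move=> h; rewrite integral0_eq; first by rewrite mule_ge0// lee_fin.
  by move=> s _; rewrite (negbTE (h s)).
(* For [l <= 1] the rescaled point is nearer to 0, hence still in [D]. The case [z = 0] is included,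
   as division by 0 gives [l = 0]. *)
have [l1|l1] := leP l 1%R.
  apply: zero => s; apply/negP => /and3P[/andP[s1 _] Ds /negP]; apply.
  rewrite mulrC -scalerA; apply: starD => //.
  by rewrite l1 divr_ge0// vnorm_ge0.
have l0 : (0 < l)%R by exact: lt_trans l1.
have il : (l^-1 = vnorm z / vnorm w)%R by rewrite invfM invrK mulrC.
have [[s0 es0]|h] := pselect (exists s, escape s z w); last first.
  by apply: zero => s; apply/negP => es; apply: h; exists s.
pose S := [set s | escape s z w].
have S2 : ubound S 2%R by move=> s /and3P[/andP[]].
have hS : has_sup S by split; [exists s0|exists 2%R].
pose b := sup S.
have b2 : (b <= 2)%R by apply: ge_sup => //; exists s0.
have Sb s : S s -> (s <= b)%R by move=> Ss; apply: sup_upper_bound.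
(* For [s] and [s'] in [S], [s' > s l] is impossible: [s' z] is in [D], so [s l z] would be too. *)
have bS s : S s -> (b / l <= s)%R.
  move=> Ss; rewrite ler_pdivrMr//; apply: ge_sup; first by exists s0.
  move=> s' Ss'; rewrite leNgt; apply/negP => slt.
  have /and3P[/andP[s1 _] _ /negP] := Ss; apply.
  have /and3P[/andP[s'1 _] Ds' _] := Ss'.
  have s'0 : (0 < s')%R by exact: lt_le_trans s'1.
  rewrite (_ : _ *: z = (s * l / s') *: (s' *: z)); last first.
    by rewrite scalerA divfK// gt_eqF.
  have s00 : (0 <= s)%R by exact: le_trans s1.
  apply: starD => //; apply/andP; split; last first.
    by rewrite ler_pdivrMr// mul1r ltW.
  by apply: divr_ge0; [apply: mulr_ge0 => //; exact: ltW|exact: ltW].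
have b1 : (1 <= b)%R.
  by apply: le_trans (Sb _ es0); have /and3P[/andP[]] := es0.
have blb : (b / l <= b)%R by rewrite ler_pdivrMr// ler_peMr; lra.
apply: (@le_trans _ _ (\int[mu]_s (\1_(`[(b / l)%R, b]%classic) s)%:E)).
  apply: ge0_le_integral => //.
  - by apply: meas_escape; msolve.
  - by apply/measurable_EFinP; exact: measurable_indic.
  move=> s _; rewrite lee_fin indicE.
  have [es|_] := boolP (escape s z w); last exact: ler0n.
  by rewrite mem_set//= in_itv/= bS ?Sb.
rewrite integral_indic// setIT.
have mub : mu `[(b / l)%R, b]%classic = (b - b / l)%:E.
  rewrite lebesgue_measure_itv/= lte_fin; case: ifPn => [_|]; first by rewrite EFinB.
  by rewrite -leNgt => bbl; congr EFin; apply/esym/eqP; rewrite subr_eq0 eq_le bbl.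
rewrite [leLHS](_ : _ = (b - b / l)%:E); last exact: mub.
rewrite -EFinM lee_fin il -[X in (X - _)%R](mulr1 b) -mulrBr.
apply: ler_pM => //; [lra|by rewrite subr_ge0 -il invf_le1// ltW|].
by rewrite le_max lexx orbT.
Qed.

(** The factor [2 ^ r] is the cost of stretching; the factor 2 bounds the upper end of the interval
    of [s] on each ray. *)
Lemma Egauss_escape :
  Egauss (fun z => Egauss (fun w : 'cV[R]_m.+1 =>
    (D z && ~~ D (vnorm w *: normalize z))%:R%:E)) <=
  (2 ^+ r * 2)%:E * Egauss (fun z : 'cV[R]_m.+1 => Egauss (fun w : 'cV[R]_m.+1 =>
    (Num.max 0 (1 - vnorm z / vnorm w))%R%:E)).
Proof.
set f := fun z => Egauss _; set A := Egauss f.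
have f0 z : 0 <= f z by apply: Egauss_ge0 => w; rewrite lee_fin.
have A0 : 0 <= A by exact: Egauss_ge0.
have mf : measurable_fun setT f.
  apply: (measurable_Egauss (f := fun z w =>
    (D z && ~~ D (vnorm w *: normalize z))%:R%:E)) => [z w|]; first by rewrite lee_fin.
  apply: meas_EFin; apply: meas_bool; apply: measurable_and.
    by apply: meas_D; msolve.
  by apply: measurable_neg; apply: meas_D; msolve.
pose h s z := Egauss (fun w => (escape s z w)%:R%:E : \bar R).
have h0 s z : 0 <= h s z by apply: Egauss_ge0 => w; rewrite lee_fin.
have mh : measurable_fun setT (fun p : measurableTypeR R * 'cV[R]_m.+1 => h p.1 p.2).
  apply: (measurable_Egauss (f := fun p w => (escape p.1 p.2 w)%:R%:E)) => [p w|].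
    by rewrite lee_fin.
  by apply: meas_escape; msolve.
have mh1 s : measurable_fun setT (h s).
  exact: (measurableT_comp mh (pair1_measurable (s : measurableTypeR R))).
have mEh : measurable_fun setT (fun s : measurableTypeR R => Egauss (h s)).
  exact: measurable_Egauss.
have [c [c0 cE]] : exists c : R, (0 <= c)%R /\ c = (2 ^+ r)%R.
  by exists (2 ^+ r)%R; rewrite exprn_ge0.
have Eh0 s : 0 <= Egauss (h s) by apply: Egauss_ge0 => z; exact: h0.
have step s : A * (\1_`[1%R, 2%R]%classic s)%:E <= c%:E * Egauss (h s).
  rewrite indicE; have [|_] := boolP (s \in _); last first.
    by rewrite mule0; apply: mule_ge0; [rewrite lee_fin|exact: Eh0].
  rewrite inE/= in_itv/= => s12; rewrite mule1.
  apply: le_trans (Egauss_stretch rm s12 f0 mf) _; rewrite -cE.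
  apply: lee_wpmul2l; first by rewrite lee_fin.
  apply: le_Egauss => [z|||z].
  - exact: f0.
  - exact: (measurableT_comp mf (@measurable_dscale _ _ _)).
  - exact: mh1.
  have /andP[s1 s2] := s12; have s0 : (0 < s)%R by exact: lt_le_trans s1.
  rewrite /f /h /=; apply: le_Egauss => [w|||w].
  - by rewrite lee_fin.
  - apply: meas_EFin; apply: meas_bool; apply: measurable_and; first exact: measurable_cst.
    by apply: measurable_neg; apply: meas_D; msolve.
  - by apply: meas_escape; msolve.
  suff : D (dscale (stretch r s) z) &&
      ~~ D (vnorm w *: normalize (dscale (stretch r s) z)) -> escape s z w.
    by case: (D _ && _) => [->//|_]; rewrite lee_fin ler0n.
  rewrite /escape s12 cylD// => /andP[-> /=]; apply: contra.
  set z' := dscale _ z.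
  have [/eqP|z0] := eqVneq (sqn z) 0%R.
    move=> /eqP /sqn_eq0 z0; rewrite /z' z0 scaler0.
    have -> : dscale (stretch r s) (0 : 'cV[R]_m.+1) = 0%R.
      by apply/colP => i; rewrite !mxE mulr0.
    by rewrite /normalize !scaler0.
  have nz : (0 < vnorm z)%R by rewrite vnorm_gt0 lt_neqAle eq_sym z0 sqn_ge0.
  (* Stretching increases the norm, so normalizing by [|z'|] gives a point nearer to 0 than
     normalizing by [|z|]; star-shapedness then compares the two. *)
  have nzz' : (vnorm z <= vnorm z')%R by rewrite ler_sqrt ?sqn_ge0 ?sqn_stretch_ge.
  have nz' : (0 < vnorm z')%R by exact: lt_le_trans nzz'.
  rewrite /normalize -/(vnorm z') scalerA /z' -dscaleZ cylD// scalerA -/z'.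
  move=> Dz; rewrite (_ : _ *: z = (vnorm z / vnorm z') *:
    ((s * (vnorm w / vnorm z)) *: z)).
    by apply: starD => //; rewrite divr_ge0 ?vnorm_ge0//= ler_pdivrMr// mul1r.
  rewrite scalerA; congr (_ *: _); field.
  by rewrite !gt_eqF.
(* The interval [1, 2] has length 1, so [A] is its own average over it. *)
have A1 : A = \int[mu]_s (A * (\1_`[1%R, 2%R]%classic s)%:E).
  rewrite ge0_integralZl//; last by apply/measurable_EFinP; exact: measurable_indic.
  rewrite integral_indic// setIT.
  have mu12 : mu `[1%R, 2%R]%classic = 1.
    by rewrite lebesgue_measure_itv/= lte_fin ltr1n/= -EFinB; congr EFin; lra.
  by rewrite [X in _ * X](_ : _ = 1) ?mule1//; exact: mu12.
rewrite A1; apply: (@le_trans _ _ (\int[mu]_s (c%:E * Egauss (h s)))).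
  apply: ge0_le_integral => [//|s _|||s _].
  - by apply: mule_ge0; [exact: A0|rewrite lee_fin].
  - apply: emeasurable_funM; first exact: measurable_cst.
    by apply/measurable_EFinP; exact: measurable_indic.
  - by apply: emeasurable_funM; [exact: measurable_cst|exact: mEh].
  - exact: step.
rewrite ge0_integralZl_EFin; [|exact: measurableT|by move=> s _; exact: Eh0
  |exact: mEh|exact: c0].
rewrite integral_Egauss; [|exact: h0|exact: mh].
rewrite -cE EFinM -muleA; apply: lee_wpmul2l; first by rewrite lee_fin.
have mmax : measurable_fun setT (fun p : 'cV[R]_m.+1 * 'cV[R]_m.+1 =>
    (Num.max 0 (1 - vnorm p.1 / vnorm p.2))%R%:E).
  by apply: meas_EFin; apply: measurable_maxr; msolve.
have max0 (z w : 'cV[R]_m.+1) : 0 <= (Num.max 0 (1 - vnorm z / vnorm w))%R%:E.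
  by rewrite lee_fin le_max lexx.
have mE := measurable_Egauss (f := fun z w : 'cV[R]_m.+1 =>
  (Num.max 0 (1 - vnorm z / vnorm w))%R%:E) max0 mmax.
rewrite -EgaussZl; [|by rewrite lee_fin|by move=> z; exact: Egauss_ge0|exact: mE].
have mes z : measurable_fun setT
    (fun p : measurableTypeR R * 'cV[R]_m.+1 => (escape p.1 z p.2)%:R%:E : \bar R).
  by apply: meas_escape; msolve.
apply: le_Egauss => [z|||z].
- by apply: integral_ge0 => s _; exact: h0.
- apply: (measurable_fun_fubini_tonelli_G (m1 := mu)
    (fun p : measurableTypeR R * 'cV[R]_m.+1 => h p.1 p.2)) => // p; exact: h0.
- by apply: emeasurable_funM; [exact: measurable_cst|exact: mE].
rewrite /h integral_Egauss => [|s v|]; [|by rewrite lee_fin|exact: mes].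
have mmaxz := measurableT_comp mmax (pair1_measurable z).
rewrite -EgaussZl; [|by rewrite lee_fin|exact: max0|exact: mmaxz].
apply: le_Egauss => [w|||w].
- by apply: integral_ge0 => s _; rewrite lee_fin.
- apply: (measurable_fun_fubini_tonelli_G (m1 := mu)
    (fun p : measurableTypeR R * 'cV[R]_m.+1 => (escape p.1 z p.2)%:R%:E)) => [|p].
    exact: mes.
  by rewrite /= lee_fin.
- by apply: emeasurable_funM; [exact: measurable_cst|exact: mmaxz].
exact: integral_escape.
Qed.

End StarShaped.

(** * Measurability of convex functions *)

Section ConvexFunctions.
Context (R : realType).

Definition convex1 (f : R -> R) := forall x y t : R, 0 <= t <= 1 ->
  f (t * x + (1 - t) * y) <= t * f x + (1 - t) * f y.

(** The chord over [[x - 1, x]] bounds [f y] above, and the chord from [y] to [x + 1], which passes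
    above [(x, f x)], bounds it below. One side is enough, since [x] is only approached from the
    left: by rounding down, and below the exit radius. *)
Lemma convex1_left_lipschitz (f : R -> R) (x : R) : convex1 f ->
  exists2 M, 0 <= M &
    forall y, x - 1 <= y <= x -> `|f x - f y| <= M * (x - y).
Proof.
move=> cf; exists (`|f (x + 1) - f x| + `|f (x - 1) - f x|).
  by rewrite addr_ge0.
move=> y /andP[y1 yx]; pose h := x - y.
have h0 : 0 <= h by rewrite subr_ge0.
have h1 : h <= 1 by rewrite /h; lra.
have := cf (x - 1) x h; rewrite h0 h1 => /(_ isT).
rewrite (_ : _ * (x - 1) + _ = y); last by rewrite /h; ring.
move=> up.
have hh : 0 < 1 + h by lra.
have := cf y (x + 1) (1 + h)^-1.
rewrite invr_ge0 ltW//= invf_le1// lerDl h0 => /(_ isT).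
rewrite (_ : _ * y + _ = x); last by rewrite /h; field; rewrite -/h gt_eqF.
rewrite -(ler_pM2l hh) => lo.
have {}lo : (1 + h) * f x <= f y + h * f (x + 1).
  apply: le_trans lo _; rewrite le_eqVlt; apply/orP; left; apply/eqP.
  by field; rewrite gt_eqF.
rewrite -/h ler_norml; apply/andP; split.
- have := ler_norm (f (x - 1) - f x); have := normr_ge0 (f (x + 1) - f x).
  by move: `|_| `|_| => a b; nra.
- have := ler_norm (f (x + 1) - f x); have := normr_ge0 (f (x - 1) - f x).
  by move: `|_| `|_| => a b; nra.
Qed.

Lemma vcons_comb m (t x y : R) (v w : 'cV[R]_m) :
  vcons (t * x + (1 - t) * y) (t *: v + (1 - t) *: w) =
  t *: vcons x v + (1 - t) *: vcons y w.
Proof.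
apply/colP => i; rewrite [RHS]mxE [X in _ = X + _]mxE [X in _ = _ + X]mxE.
case: (unliftP ord0 i) => [j ->|->]; first by rewrite !vconsS !mxE.
by rewrite !vcons0.
Qed.

Lemma convex_vcons1 m (u : 'cV[R]_m.+1 -> R) v : convex_fun u ->
  convex1 (fun x => u (vcons x v)).
Proof.
move=> cu x y t t01; have := cu (vcons x v) (vcons y v) t t01.
rewrite -vcons_comb -scalerDl (_ : t + (1 - t) = 1) ?scale1r//; ring.
Qed.

Lemma convex_vcons2 m (u : 'cV[R]_m.+1 -> R) x : convex_fun u ->
  convex_fun (fun v => u (vcons x v)).
Proof.
move=> cu v w t t01; have := cu (vcons x v) (vcons x w) t t01.
rewrite -vcons_comb -mulrDl (_ : t + (1 - t) = 1) ?mul1r//; ring.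
Qed.

(* Induction on the dimension: a convex function is continuous in its first
   coordinate and measurable in the others, hence a limit of the functions
   obtained by rounding the first coordinate down to multiples of [1/n]. *)
Lemma convex_measurable m (u : 'cV[R]_m -> R) : convex_fun u ->
  measurable_fun setT (u : _ -> measurableTypeR R).
Proof.
elim: m u => [|m IH] u cu.
  rewrite (_ : u = cst (u 0)); first exact: measurable_cst.
  by apply/funext => v; congr u; apply/colP => -[].
pose tl (z : 'cV[R]_m.+1) : 'cV[R]_m := dsubmx (z : 'cV_(1 + m)).
have zE (z : 'cV[R]_m.+1) : z = vcons (z ord0 0) (tl z) by exact: vconsP.
have mtl : measurable_fun setT tl.
  apply: measurable_cVP => i; under eq_fun do rewrite mxE.
  exact: measurable_coord.
pose fl n (x : R) : int := Num.floor (x * n.+1%:R).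
pose rnd n (x : R) : R := (fl n x)%:~R / n.+1%:R.
have rndle n x : x - n.+1%:R^-1 <= rnd n x <= x.
  have n0 : 0 < n.+1%:R :> R by rewrite ltr0n.
  have /andP[l1 l2] := floor_itv (x * n.+1%:R).
  rewrite /rnd ler_pdivrMr// l1 andbT ler_pdivlMr// mulrBl mulVf ?gt_eqF//.
  by rewrite lerBlDr ltW// (lt_le_trans l2)// intrD.
apply: (measurable_fun_cvg
  (h := fun n (z : 'cV[R]_m.+1) => u (vcons (rnd n (z ord0 0)) (tl z)))).
  (* On each slab the rounded coordinate is constant, so the induction hypothesis applies. An index
     encoding no integer repeats the slab of 0, which is harmless in a countable union. *)
  move=> n; pose E i := [set z : 'cV[R]_m.+1 | fl n (z ord0 0) = odflt 0 (unpickle i)].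
  have cE : setT = \bigcup_i E i.
    apply/esym/seteqP; split => // z _; exists (pickle (fl n (z ord0 0))) => //.
    by rewrite /E/= pickleK.
  rewrite cE; apply/measurable_fun_bigcup => i.
    have -> : E i = (fun z : 'cV[R]_m.+1 =>
      ((odflt 0 (unpickle i))%:~R <= z ord0 0 * n.+1%:R) &&
      (z ord0 0 * n.+1%:R < (odflt 0 (unpickle i) + 1)%:~R)) @^-1` [set true].
      by apply/seteqP; split => z /=; rewrite /E /fl /=; [move=> <-; rewrite floor_itv|
        exact: floor_def].
    rewrite -[X in measurable X]setTI.
    have mc : measurable_fun setT (fun z : 'cV[R]_m.+1 =>
        z ord0 0 * n.+1%:R : measurableTypeR R).
      by apply: measurable_funM; [exact: measurable_coord|exact: measurable_cst].
    have mb : measurable_fun setT (fun z : 'cV[R]_m.+1 =>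
      ((odflt 0 (unpickle i))%:~R <= z ord0 0 * n.+1%:R) &&
      (z ord0 0 * n.+1%:R < (odflt 0 (unpickle i) + 1)%:~R)).
      by apply: measurable_and; msolve.
    exact: mb.
  apply: (eq_measurable_fun (fun z =>
      u (vcons ((odflt 0 (unpickle i))%:~R / n.+1%:R) (tl z)))).
    by move=> z; rewrite inE /E /= => <-.
  apply: measurable_funTS.
  apply: (measurableT_comp (f := fun v => u (vcons _ v)) _ mtl).
  by apply: IH; exact: convex_vcons2.
move=> z _; rewrite [u z](_ : _ = u (vcons (z ord0 0) (tl z))); last by rewrite -zE.
have [M M0 lip] := convex1_left_lipschitz (z ord0 0) (convex_vcons1 (tl z) cu).
apply/cvgrPdist_le => e e0; near=> n.
have M1 : 0 < M + 1 by lra.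
have n1 : n.+1%:R^-1 <= 1 :> R by rewrite invf_le1 ?ltr0n// ler1n.
have /andP[r1 r2] := rndle n (z ord0 0).
apply: le_trans (lip (rnd n (z ord0 0)) _) _; first by rewrite r2 andbT (le_trans _ r1)// lerB.
have : n.+1%:R^-1 < e / (M + 1).
  near: n; have em : 0 < e / (M + 1) by apply: divr_gt0 => //; lra.
  exact: (near_infty_natSinv_lt (PosNum em)).
rewrite ltr_pdivlMr// => h.
apply: (@le_trans _ _ ((M + 1) * n.+1%:R^-1)); last by rewrite mulrC ltW.
apply: ler_pM => //; [by rewrite subr_ge0|by rewrite lerDl|].
by rewrite lerBlDr addrC -lerBlDr.
Unshelve. all: by end_near. Qed.

End ConvexFunctions.

(** * The mass along a ray and the variance gap *)

Section RadialFunction.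
Context (R : realType) (m r : nat) (D : 'cV[R]_m.+1 -> bool).
Hypothesis rm : (r <= m.+1)%N.
Hypothesis mD : measurable_fun setT D.
Hypothesis starD : forall (t : R) z, (0 <= t <= 1)%R -> D z -> D (t *: z).
Hypothesis cylD : forall (s : R) z, (0 < s)%R ->
  D (dscale (stretch r s) z) = D (s *: z).
Local Open Scope ereal_scope.

(** Phrased by membership instead of an exit radius, so that both estimators are instances. *)
Definition radial_mass (v : 'cV[R]_m.+1) : R :=
  fine (Egauss (fun w : 'cV[R]_m.+1 => (D (vnorm w *: v))%:R%:E)).

Let mDv d (T : measurableType d) (v : T -> 'cV[R]_m.+1) :
  measurable_fun setT v -> measurable_fun setT (fun t => D (v t)).
Proof. by move=> mv; exact: (measurableT_comp mD). Qed.

Let mray v : measurable_fun setT (fun w : 'cV[R]_m.+1 => D (vnorm w *: v)).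
Proof. by apply: mDv; msolve. Qed.

Lemma Egauss_bool_le1 (b : 'cV[R]_m.+1 -> bool) : measurable_fun setT b ->
  Egauss (fun w => (b w)%:R%:E) <= 1.
Proof.
move=> mb; rewrite -(Egauss1 R m.+1); apply: le_Egauss => [w|||w].
- by rewrite lee_fin.
- exact/meas_EFin/meas_bool.
- exact: measurable_cst.
- by rewrite lee_fin lern1 leq_b1.
Qed.

Lemma Egauss_bool_fin (b : 'cV[R]_m.+1 -> bool) : measurable_fun setT b ->
  Egauss (fun w => (b w)%:R%:E) \is a fin_num.
Proof.
move=> mb; rewrite ge0_fin_numE.
  by apply: le_lt_trans (Egauss_bool_le1 mb) _; rewrite ltry.
by apply: Egauss_ge0 => w; rewrite lee_fin.
Qed.

Lemma radial_massE v : (radial_mass v)%:E =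
  Egauss (fun w : 'cV[R]_m.+1 => (D (vnorm w *: v))%:R%:E).
Proof. by rewrite fineK// Egauss_bool_fin. Qed.

Lemma radial_mass_ge0 v : (0 <= radial_mass v)%R.
Proof. by apply: fine_ge0; apply: Egauss_ge0 => w; rewrite lee_fin. Qed.

Lemma radial_mass_le1 v : (radial_mass v <= 1)%R.
Proof. by rewrite -lee_fin radial_massE Egauss_bool_le1. Qed.

Lemma measurable_radial_mass :
  measurable_fun setT (radial_mass : _ -> measurableTypeR R).
Proof.
apply: meas_fine; apply: (measurable_Egauss
  (f := fun v w : 'cV[R]_m.+1 => (D (vnorm w *: v))%:R%:E)) => [v w|].
  by rewrite lee_fin.
by apply: meas_EFin; apply: meas_bool; apply: mDv; msolve.
Qed.

Lemma radial_massC v : (1 - radial_mass v)%:E =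
  Egauss (fun w : 'cV[R]_m.+1 => (~~ D (vnorm w *: v))%:R%:E).
Proof.
have h : 1 = (radial_mass v)%:E +
    Egauss (fun w : 'cV[R]_m.+1 => (~~ D (vnorm w *: v))%:R%:E).
  rewrite radial_massE -EgaussD.
  - rewrite -(Egauss1 R m.+1); apply: eq_Egauss => w.
    by case: (D _); rewrite /= ?adde0 ?add0e.
  - by move=> w; rewrite lee_fin.
  - by move=> w; rewrite lee_fin.
  - exact/meas_EFin/meas_bool/mray.
  - by apply/meas_EFin/meas_bool; apply: measurable_neg; exact: mray.
by rewrite EFinB [X in X - _]h [X in X - _]addeC addeK.
Qed.

(** The estimator is unbiased: polar coordinates for the indicator of [D]. *)
Lemma Esph_radial_mass : Esph (fun v => (radial_mass v)%:E) =
  Egauss (fun z => (D z)%:R%:E).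
Proof.
have mpsi : measurable_fun setT (fun p : measurableTypeR R * 'cV[R]_m.+1 =>
    (D (p.1 *: p.2))%:R : measurableTypeR R).
  by apply: meas_bool; apply: mDv; msolve.
have h := polar (psi := fun t v => (D (t *: v))%:R) (fun _ _ => ler0n _ _) mpsi.
rewrite (eq_Egauss (g := fun z => (D (vnorm z *: normalize z))%:R%:E)).
  by rewrite h /Esph; congr (_ * _); apply: eq_iint => v; rewrite radial_massE.
by move=> z; rewrite scale_normalize.
Qed.

(** Polar coordinates for [1_D (t v) (1 - G v)]: the first factor becomes membership of a Gaussian
    [z], and [1 - G] is the chance that an independent radius [|w|] on the ray of [z] falls outside
    [D]. *)
Lemma Esph_radial_variance :
  Esph (fun v => (radial_mass v * (1 - radial_mass v))%:E) <=
  (2 ^+ r * 2 * (8 * moment_cst R + 1) / Num.sqrt m.+1%:R)%:E.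
Proof.
have mG := measurable_radial_mass.
have G1 v : (0 <= 1 - radial_mass v)%R by rewrite subr_ge0 radial_mass_le1.
have psi0 (t : R) v : (0 <= (D (t *: v))%:R * (1 - radial_mass v))%R.
  by rewrite mulr_ge0.
have mpsi : measurable_fun setT (fun p : measurableTypeR R * 'cV[R]_m.+1 =>
    ((D (p.1 *: p.2))%:R * (1 - radial_mass p.2))%R : measurableTypeR R).
  apply: measurable_funM; first by apply: meas_bool; apply: mDv; msolve.
  by apply: measurable_funB; [msolve|exact: measurableT_comp].
have h := polar psi0 mpsi.
rewrite [leLHS](_ : _ = Egauss (fun z => Egauss (fun w : 'cV[R]_m.+1 =>
    (D z && ~~ D (vnorm w *: normalize z))%:R%:E))).
  apply: le_trans (Egauss_escape rm mD starD cylD) _.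
  rewrite -mulrA [leRHS]EFinM; apply: lee_wpmul2l; last exact: Egauss_radii_ratio.
  by rewrite lee_fin mulr_ge0// exprn_ge0.
transitivity (Esph (fun u => Egauss (fun w : 'cV[R]_m.+1 =>
    ((D (vnorm w *: u))%:R * (1 - radial_mass u))%:E))).
  rewrite /Esph; congr (_ * _); apply: eq_iint => v; case: ifP => // _.
  rewrite EFinM muleC radial_massE -EgaussZl ?lee_fin//; last first.
    exact/meas_EFin/meas_bool/mray.
  by apply: eq_Egauss => w; rewrite muleC.
rewrite -h; apply: eq_Egauss => z; rewrite scale_normalize EFinM radial_massC.
rewrite -EgaussZl ?lee_fin//; last first.
  by apply/meas_EFin/meas_bool; apply: measurable_neg; exact: mray.
by apply: eq_Egauss => w; rewrite -EFinM -natrM mulnb.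
Qed.

(** [E G = E G^2 + E (G (1 - G))], so [p - q] is the quantity just bounded. *)
Lemma star_shaped_gap (p : R) : p%:E = Egauss (fun z => (D z)%:R%:E) ->
  exists2 q : R, Esph (fun v => (radial_mass v ^+ 2)%:E) = q%:E &
    (p - q <= 2 ^+ r * 2 * (8 * moment_cst R + 1) / Num.sqrt m.+1%:R)%R.
Proof.
move=> pE; have mG := measurable_radial_mass.
have G0 := radial_mass_ge0.
have G1 v : (0 <= 1 - radial_mass v)%R by rewrite subr_ge0 radial_mass_le1.
have h : Esph (fun v => (radial_mass v)%:E) =
    Esph (fun v => (radial_mass v ^+ 2)%:E) +
    Esph (fun v => (radial_mass v * (1 - radial_mass v))%:E).
  rewrite -EsphD.
  - rewrite /Esph; congr (_ * _); apply: eq_iint => v; case: ifP => // _.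
    by rewrite -EFinD; congr EFin; ring.
  - by move=> v; rewrite lee_fin; exact: exprn_ge0.
  - by move=> v; rewrite lee_fin; exact: mulr_ge0.
  - by apply: meas_EFin; exact: meas_X.
  - apply: meas_EFin; apply: measurable_funM => //.
    by apply: measurable_funB => //; msolve.
move: h; rewrite Esph_radial_mass -pE; have := Esph_radial_variance.
set s := Esph _; set q := Esph _ => sC ps.
have q0 : 0 <= q by apply: Esph_ge0 => v; rewrite lee_fin; exact: exprn_ge0.
have s0 : 0 <= s by apply: Esph_ge0 => v; rewrite lee_fin; exact: mulr_ge0.
(* Two nonnegative extended reals with a real sum are both real. *)
move: q s ps sC q0 s0 => [q| |] [s| |] //=; rewrite ?addye ?addey //.
rewrite -EFinD => -[->]; rewrite lee_fin => sC _ _; exists q => //; lra.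
Qed.

End RadialFunction.

(** * Marginals of the standard Gaussian *)

Section Marginal.
Context (R : realType).
Notation mu := (@lebesgue_measure R).
Local Open Scope ereal_scope.

Definition take_coords m r (rm : (r <= m)%N) (z : 'cV[R]_m) : 'cV[R]_r :=
  \col_i z (widen_ord rm i) 0%R.

Let gdens1 (x : R) : R := ((Num.sqrt (2 * pi))^-1 * expR (- x ^+ 2 / 2))%R.

Let gdens_vcons m x (v : 'cV[R]_m) : gdens (vcons x v) = (gdens1 x * gdens v)%R.
Proof.
rewrite /gdens sqn_vcons /gdens1 exprS.
rewrite (_ : - (x ^+ 2 + sqn v) / 2 = - x ^+ 2 / 2 + - sqn v / 2)%R; last by ring.
rewrite expRD.
by move: (expR _) (expR _) => a b; ring.
Qed.

Let EgaussS m (f : 'cV[R]_m.+1 -> \bar R) : (forall v, 0 <= f v) ->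
  measurable_fun setT f ->
  Egauss f = \int[mu]_x ((gdens1 x)%:E * Egauss (fun v => f (vcons x v))).
Proof.
move=> f0 mf; rewrite [LHS]iintS; apply: eq_integral => x _; rewrite -iintZl.
- by apply: eq_iint => v; rewrite gdens_vcons EFinM muleA.
- by rewrite lee_fin mulr_ge0 ?invr_ge0 ?sqrtr_ge0 ?expR_ge0.
- by move=> v; apply: mule_ge0 => //; rewrite lee_fin gdens_ge0.
- by apply: meas_gdensM; exact: measurable_vcons1.
Qed.

Lemma measurable_take_coords m r (rm : (r <= m)%N) :
  measurable_fun setT (take_coords rm).
Proof.
by apply: measurable_cVP => i; under eq_fun do rewrite mxE; exact: measurable_coord.
Qed.

(** The shared coordinates are peeled off together; once they are exhausted, the integrand is
    constant and the remaining mass is 1. This carries [Fchi r] and [phi] from R^r to R^K. *)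
Lemma Egauss_marginal m r (rm : (r <= m)%N) (f : 'cV[R]_r -> \bar R) :
  (forall v, 0 <= f v) -> measurable_fun setT f ->
  Egauss (fun z => f (take_coords rm z)) = Egauss f.
Proof.
elim: r m rm f => [|r IH] [|m] rm f f0 mf //.
- by rewrite /Egauss /=; congr (_ * f _); apply/colP => -[].
- have fE z : f z = f 0%R by congr f; apply/colP => -[].
  rewrite (_ : (fun z => _) = fun=> f 0%R); last by apply/funext => z; exact: fE.
  rewrite Egauss_cst//.
  by rewrite /Egauss/= /gdens /sqn big_ord0 expr0 oppr0 mul0r expR0 mulr1 mul1e.
have rm' : (r <= m)%N by [].
have mF := measurableT_comp mf (measurable_take_coords rm).
rewrite (EgaussS (fun v => f0 _) mF) EgaussS//.
apply: eq_integral => x _; congr (_ * _).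
rewrite -(IH _ rm') => [|//|]; last exact: measurable_vcons1.
apply: eq_Egauss => v; congr f; apply/colP => i; rewrite [LHS]mxE.
case: (unliftP ord0 i) => [j ->|->].
  rewrite [RHS]vconsS [RHS]mxE (_ : widen_ord rm (lift ord0 j) = lift ord0 (widen_ord rm' j)).
    by rewrite vconsS.
  exact/val_inj.
by rewrite (_ : widen_ord rm ord0 = ord0) ?vcons0//; exact/val_inj.
Qed.

End Marginal.

(** * The two estimators *)

Section Applications.
Context (R : realType).
Notation rate r m :=
  (2 ^+ r * 2 * (8 * moment_cst R + 1) / Num.sqrt m.+1%:R : R).

Lemma LK_mulmx n r K (rK : (r <= K)%N) (L : 'M[R]_(n, r)) (z : 'cV[R]_K) :
  LK L K *m z = L *m take_coords rK z.
Proof.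
apply/colP => i; rewrite !mxE.
under eq_bigr => j _ do rewrite mxE mulr_suml big_mkcond/=.
rewrite exchange_big; apply: eq_bigr => k _ /=; rewrite mxE.
rewrite (bigD1 (widen_ord rK k))//= eqxx big1 ?addr0// => j jk.
by case: eqP => // kj; case/eqP: jk; apply/val_inj.
Qed.

Lemma take_coords_stretch r K (rK : (r <= K)%N) s (z : 'cV[R]_K) :
  take_coords rK (dscale (stretch r s) z) = s *: take_coords rK z.
Proof. by apply/colP => i; rewrite !mxE /stretch/= ltn_ord. Qed.

Lemma take_coordsZ r K (rK : (r <= K)%N) s (z : 'cV[R]_K) :
  take_coords rK (s *: z) = s *: take_coords rK z.
Proof. by apply/colP => i; rewrite !mxE. Qed.

Lemma tau_take_coords r K (rK : (r <= K)%N) (z : 'cV[R]_K) :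
  tau r z = sqn (take_coords rK z).
Proof.
(* Squared coordinates as a function on [nat], so that sums over ['I_r] and ['I_K] can be
   compared. *)
pose F (i : nat) : R := (nth 0 [seq z j 0 | j : 'I_K] i) ^+ 2.
have FE (j : 'I_K) : F j = z j 0 ^+ 2.
  by rewrite /F (nth_map j) ?size_enum_ord// nth_ord_enum.
rewrite /tau /sqn; transitivity (\sum_(i < r) F i).
  by rewrite (big_ord_widen _ F rK); apply: eq_bigr => j _; rewrite FE.
by apply: eq_bigr => i _; rewrite mxE -FE.
Qed.

(** * The fixed radius: the cylinder over a ball of R^r *)

Section Ellipsoid.
Context (m r : nat) (rm : (r <= m.+1)%N) (c : R) (c0 : 0 < c).
(** The ray of direction [v] leaves this set at radius [c / sqrt (tau v)], or never if [tau v = 0];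
    thus [W_K] is the variance of the radial mass. *)
Let D (z : 'cV[R]_m.+1) : bool := tau r z <= c ^+ 2.

Let tauZ s (z : 'cV[R]_m.+1) : tau r (s *: z) = s ^+ 2 * tau r z.
Proof. by rewrite !(tau_take_coords rm) take_coordsZ sqnZ. Qed.

Let tau_ge0 (z : 'cV[R]_m.+1) : 0 <= tau r z.
Proof. by rewrite (tau_take_coords rm) sqn_ge0. Qed.

Let mD : measurable_fun setT D.
Proof.
have -> : D = fun z => sqn (take_coords rm z) <= c ^+ 2.
  by apply/funext => z; rewrite /D (tau_take_coords rm).
apply: meas_le; last exact: measurable_cst.
by apply: meas_sqn; exact: measurable_take_coords.
Qed.

Let starD (t : R) z : 0 <= t <= 1 -> D z -> D (t *: z).
Proof.
move=> /andP[t0 t1]; rewrite /D tauZ; apply: le_trans.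
by rewrite ler_piMl// expr_le1.
Qed.

Let cylD (s : R) z : 0 < s -> D (dscale (stretch r s) z) = D (s *: z).
Proof.
by move=> s0; rewrite /D !(tau_take_coords rm) take_coords_stretch take_coordsZ.
Qed.

Let FchiE (v : 'cV[R]_m.+1) :
  Fchi m.+1 (if tau r v == 0 then +oo%E else (c / Num.sqrt (tau r v))%:E) =
  radial_mass D v.
Proof.
rewrite /Fchi /radial_mass; congr fine; apply: eq_Egauss => w.
rewrite -/(vnorm w) /D tauZ; case: eqVneq => [->|t0].
  by rewrite leey mulr0 exprn_ge0// ltW.
have st : 0 < Num.sqrt (tau r v) by rewrite sqrtr_gt0 lt_neqAle eq_sym t0 tau_ge0.
rewrite lee_fin ler_pdivlMr// -{2}(sqr_sqrtr (tau_ge0 v)) -exprMn.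
rewrite ler_sqr ?nnegrE ?mulr_ge0 ?vnorm_ge0 ?sqrtr_ge0 ?(ltW c0)//.
by case: ifP.
Qed.

Let FchirE : (Fchi r c%:E)%:E = Egauss (fun z => (D z)%:R%:E : \bar R).
Proof.
have mball : measurable_fun setT (fun y : 'cV[R]_r => (sqn y <= c ^+ 2)%R%:R%:E : \bar R).
  by msolve.
have -> : Egauss (fun z => (D z)%:R%:E : \bar R) =
    Egauss (fun y : 'cV[R]_r => (sqn y <= c ^+ 2)%R%:R%:E : \bar R).
  rewrite -(Egauss_marginal rm)//; apply: eq_Egauss => z.
  by rewrite /D (tau_take_coords rm).
rewrite /Fchi (eq_Egauss (g := fun y : 'cV[R]_r => (sqn y <= c ^+ 2)%R%:R%:E : \bar R)).
  rewrite -(Egauss_marginal rm)// fineK//.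
  apply: (Egauss_bool_fin (b := fun z => sqn (take_coords rm z) <= c ^+ 2)).
  by apply: meas_le; [apply: meas_sqn; exact: measurable_take_coords|msolve].
move=> y; rewrite lee_fin -[in RHS](sqr_sqrtr (sqn_ge0 y)).
by rewrite ler_sqr ?nnegrE ?sqrtr_ge0 ?(ltW c0)//; case: ifP.
Qed.

(** As [E G = p], [E (G - p)^2 = E G^2 - p^2], and [p (1 - p)] minus this is [p - E G^2]. *)
Lemma W_gap : ((W_MC r c)%:E - W_K r m.+1 c <= (rate r m)%:E)%E.
Proof.
have [q qE pq] := star_shaped_gap rm mD starD cylD FchirE.
have EG := Esph_radial_mass mD; move: EG; rewrite -FchirE.
rewrite /W_MC; set p := Fchi r c%:E in pq * => EG.
have mG := measurable_radial_mass mD.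
have p0 : 0 <= p.
  by rewrite -lee_fin -EG; apply: Esph_ge0 => v; rewrite lee_fin radial_mass_ge0.
have -> : W_K r m.+1 c = Esph (fun v => ((radial_mass D v - p) ^+ 2)%:E).
  by rewrite /W_K; congr Esph; apply/funext => v; rewrite /= FchiE.
have sqr0 (h : 'cV[R]_m.+1 -> R) v : (0 <= (h v ^+ 2)%:E)%E by rewrite lee_fin sqr_ge0.
have p20 (v : 'cV[R]_m.+1) : (0 <= (p ^+ 2)%:E)%E by rewrite lee_fin sqr_ge0.
have pG0 v : (0 <= (2 * p)%:E * (radial_mass D v)%:E)%E.
  by rewrite mule_ge0// lee_fin ?radial_mass_ge0// mulr_ge0.
have mGp : measurable_fun setT (fun v => ((radial_mass D v - p) ^+ 2)%:E).
  by apply/meas_EFin/meas_X; apply: measurable_funB => //; exact: measurable_cst.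
have mpG : measurable_fun setT (fun v => (2 * p)%:E * (radial_mass D v)%:E)%E.
  by apply: emeasurable_funM; [exact: measurable_cst|exact: meas_EFin].
(* The square is expanded with the cross term moved to the left, which keeps all integrands
   nonnegative, as [EsphD] demands. *)
have : (Esph (fun v => ((radial_mass D v - p) ^+ 2)%:E) +
    (2 * p)%:E * Esph (fun v => (radial_mass D v)%:E) =
    Esph (fun v => (radial_mass D v ^+ 2)%:E) +
    Esph (fun _ : 'cV[R]_m.+1 => (p ^+ 2)%:E))%E.
  rewrite -EsphZl; [|by rewrite lee_fin mulr_ge0|by move=> v; rewrite lee_fin radial_mass_ge0
    |exact: meas_EFin].
  rewrite -(EsphD (sqr0 (fun v => radial_mass D v - p)) pG0 mGp mpG).
  rewrite -(EsphD (sqr0 (radial_mass D)) p20 _ (measurable_cst _)); last first.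
    exact/meas_EFin/meas_X.
  congr Esph; apply/funext => v; rewrite -EFinM -!EFinD; congr EFin; ring.
rewrite EG qE Esph_cst ?lee_fin ?sqr_ge0// -EFinM -EFinD.
case: (Esph _) => [w| |]//=; rewrite -EFinD => -[wE].
have -> : w = q + p ^+ 2 - 2 * p * p by rewrite -wE addrK.
rewrite -EFinB lee_fin; apply: le_trans pq; rewrite le_eqVlt.
by apply/orP; left; apply/eqP; ring.
Qed.

End Ellipsoid.

(** * The convex constraint *)

Section ConvexSublevel.
Context (m r n : nat) (rm : (r <= m.+1)%N).
Context (zb : 'cV[R]_n) (L : 'M[R]_(n, r)) (g : 'cV[R]_n -> R).
Hypothesis cg : convex_fun g.
Hypothesis gzb : g zb < 0.

Let convex_affine k (A : 'M[R]_(n, k)) : convex_fun (fun z => g (zb + A *m z)).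
Proof.
move=> x y t t01; apply: le_trans (cg _ _ t01); rewrite le_eqVlt; apply/orP; left.
apply/eqP; congr g; rewrite mulmxDr -!scalemxAr !scalerDr addrACA -scalerDl.
by rewrite (_ : t + (1 - t) = 1) ?scale1r//; ring.
Qed.

Let u (z : 'cV[R]_m.+1) : R := g (zb + LK L m.+1 *m z).
Let D (z : 'cV[R]_m.+1) : bool := u z <= 0.

Let u0 : u 0 < 0. Proof. by rewrite /u mulmx0 addr0. Qed.

Let mD : measurable_fun setT D.
Proof.
apply: meas_le; last exact: measurable_cst.
by apply: convex_measurable; exact: convex_affine.
Qed.

(** On the segment from 0 to [z], [u] lies below the chord, whose end values are negative and
    nonpositive. *)
Let starD (t : R) z : 0 <= t <= 1 -> D z -> D (t *: z).
Proof.
move=> t01; have := convex_affine (LK L m.+1) z 0 t01.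
rewrite scaler0 addr0 -/(u _) -/(u _) -/(u _) => h uz; apply: le_trans h _.
by have /andP[t0 t1] := t01; move: uz u0; rewrite /D; nra.
Qed.

Let cylD (s : R) z : 0 < s -> D (dscale (stretch r s) z) = D (s *: z).
Proof.
by move=> s0; rewrite /D /u !(LK_mulmx rm) take_coords_stretch take_coordsZ.
Qed.

(** If [t v] is outside [D], then by left continuity so is a whole segment just below it, and by
    star-shapedness everything beyond it; hence [rho] is strictly less than [t]. *)
Let le_rho (v : 'cV[R]_m.+1) (t : R) : 0 <= t ->
  (t%:E <= rho zb L g v)%E = D (t *: v).
Proof.
have uZ s : g (zb + s *: (LK L m.+1 *m v)) = u (s *: v).
  by rewrite /u scalemxAr.
move=> t0; apply/idP/idP => [|Dt]; last first.
  by apply: ereal_sup_ubound; exists t => //=; rewrite uZ.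
apply: contraLR; rewrite -ltNge /D -ltNge => ut.
have cu : convex1 (fun s => u (s *: v)).
  move=> x y s s01; have := convex_affine (LK L m.+1) (x *: v) (y *: v) s01.
  by rewrite !scalerA -scalerDl.
have [M M0 lip] := convex1_left_lipschitz t cu.
have M1 : 0 < M + 1 by lra.
(* [e <= 1] stays in the range of the Lipschitz bound, and [e (M + 1) <= u (t v)] keeps [u] positive
   on the segment; [M + 1] replaces [M], which may be 0. *)
pose e := Num.min 1 (u (t *: v) / (M + 1)).
have e0 : 0 < e by rewrite lt_min ltr01 divr_gt0.
apply: (@le_lt_trans _ _ (t - e)%:E); last by rewrite lte_fin; lra.
apply: ge_ereal_sup => _ [s [/= s0 us] <-]; rewrite lee_fin leNgt; apply/negP => es.
move: us; rewrite uZ => us.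
have [st|ts] := leP s t.
  have e1 : e <= 1 by rewrite ge_min lexx.
  have eu : e * (M + 1) <= u (t *: v) by rewrite -ler_pdivlMr// ge_min lexx orbT.
  have h : `|u (t *: v) - u (s *: v)| <= M * (t - s).
    by apply: lip; rewrite st andbT; lra.
  by have := le_trans (ler_norm _) h; nra.
have : D (t / s *: (s *: v)).
  apply: starD => //; rewrite divr_ge0//= ler_pdivrMr ?mul1r ?ltW//.
  exact: le_lt_trans ts.
rewrite scalerA divfK ?gt_eqF//; last exact: le_lt_trans ts.
by rewrite /D leNgt ut.
Qed.

Let FchiE (v : 'cV[R]_m.+1) : Fchi m.+1 (rho zb L g v) = radial_mass D v.
Proof.
rewrite /Fchi /radial_mass; congr fine; apply: eq_Egauss => w.
by rewrite le_rho ?sqrtr_ge0//; case: ifP.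
Qed.

Let phiE : (phi zb L g)%:E = Egauss (fun z => (D z)%:R%:E : \bar R).
Proof.
have mg : measurable_fun setT (fun y : 'cV[R]_r => (g (zb + L *m y) <= 0)%R%:R%:E : \bar R).
  apply: meas_EFin; apply: meas_bool; apply: meas_le; last exact: measurable_cst.
  by apply: convex_measurable; exact: convex_affine.
have <- : Egauss (fun y : 'cV[R]_r => (g (zb + L *m y) <= 0)%R%:R%:E : \bar R) =
    Egauss (fun z => (D z)%:R%:E : \bar R).
  rewrite -(Egauss_marginal rm)//; apply: eq_Egauss => z.
  by rewrite /D /u (LK_mulmx rm).
rewrite /phi (eq_Egauss (g := fun y : 'cV[R]_r => (g (zb + L *m y) <= 0)%R%:R%:E : \bar R)).
  rewrite -(Egauss_marginal rm)// (eq_Egauss (g := fun z => (D z)%:R%:E)).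
    by rewrite fineK// Egauss_bool_fin.
  by move=> z; rewrite /D /u (LK_mulmx rm).
by move=> y; case: ifP.
Qed.

(** Both variances subtract the same squared mean [phi^2], which leaves [phi - E G^2]. *)
Lemma V_gap : ((V_MC zb L g)%:E - V_K zb L g m.+1 <= (rate r m)%:E)%E.
Proof.
have [q qE pq] := star_shaped_gap rm mD starD cylD phiE.
have EG := Esph_radial_mass mD; move: EG; rewrite -phiE => EG.
rewrite /V_K /V_MC.
under [X in Esph X]eq_fun do rewrite FchiE.
under [X in (_ - Esph X ^+ 2)%E]eq_fun do rewrite FchiE.
rewrite qE EG; move: (phi zb L g) pq => p pq.
rewrite -EFin_expe -!EFinB lee_fin; apply: le_trans pq; rewrite le_eqVlt.
by apply/orP; left; apply/eqP; ring.
Qed.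

End ConvexSublevel.
End Applications.

Theorem theorem2p2 (R : realType) (r : nat) (hr : (1 <= r)%N) :
  exists C : R, 0 < C /\
    forall K : nat, (r <= K)%N ->
      (forall c : R, 0 < c ->
         ((W_MC r c)%:E - W_K r K c <= (C / Num.sqrt K%:R)%:E)%E) /\
      (forall (n : nat) (zb : 'cV[R]_n) (L : 'M[R]_(n, r)) (g : 'cV[R]_n -> R),
         convex_fun g -> g zb < 0 ->
         ((V_MC zb L g)%:E - V_K zb L g K <= (C / Num.sqrt K%:R)%:E)%E).
Proof.
(* [2 ^ r * 2] is the cost of smoothing along rays, and [8 M + 1] that of comparing the two
   radii. *)
exists (2 ^+ r * 2 * (8 * moment_cst R + 1)); split.
  by rewrite !mulr_gt0 ?exprn_gt0// ltr_wpDl// mulr_ge0// moment_cst_ge0.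
move=> [|m] rm; first by move: hr; rewrite leqNgt ltnS rm.
by split => [c c0|n zb L g cg gzb]; [exact: W_gap|exact: V_gap].
Qed.
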